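(* There exists an absolute constant $c>1$ such that the following holds with probability at least $1-2n^{-2}$. Let $n_1,n_2,d_1,d_2,r$ be positive integers with $r\le d_i\le n_i$, $n=\max\{n_1,n_2\}$. Let $A\in\mathbb R^{n_1\times d_1}$, $B\in\mathbb R^{n_2\times d_2}$ be isometries with $\|A\|_{2,\infty}\le\sqrt{\mu d_1/n_1}$ and $\|B\|_{2,\infty}\le\sqrt{\mu d_2/n_2}$, and let $X^*\in\mathbb R^{n_1\times n_2}$ be a rank-$r$ matrix whose column space lies in the column span of $A$ and whose row space lies in the column span of $B$. Let $\sigma_r^*=\sigma_r(X^* )$ and $\gamma=c/(2\sigma_r^* )$. Let $\Omega\subseteq[n_1]\times[n_2]$ be drawn uniformly at random among subsets of size $|\Omega|\ge 32\mu^2d_1d_2\log n$, and let $Y=\mathcal P_\Omega(X^* )$. Then for any initial pair $(U_0,V_0)\in\mathbb R^{d_1\times r}\times\mathbb R^{d_2\times r}$ satisfying $$\|AU_0V_0^\top B^\top-X^*\|_F\le\sigma_r^*/c\quad\text{and}\quad\|U_0^\top U_0-V_0^\top V_0\|_F\le\sigma_r^*/(2c),$$ the iterates of GNIMC, $X_t=AU_tV_t^\top B^\top$, satisfy $$\|X_{t+1}-X^*\|_F\le\gamma\,\|X_t-X^*\|_F^2\quad\text{for all }t=0,1,2,\dots.$$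
   Context: An isometry is a matrix $A$ with $A^\top A=I$; $\|X\|_{2,\infty}$ is the largest Euclidean row norm of $X$; $\sigma_r(X)$ is the $r$-th largest singular value. $\mathcal P_\Omega(X)$ keeps the entries $X_{ij}$, $(i,j)\in\Omega$, and zeros the others. GNIMC (Gauss–Newton inductive matrix completion): given $(U_t,V_t)$, let $(\Delta U_{t+1},\Delta V_{t+1})$ be, among all minimizers over $(\Delta U,\Delta V)\in\mathbb R^{d_1\times r}\times\mathbb R^{d_2\times r}$ of the linear least squares problem $$\|\mathcal P_\Omega[A(U_tV_t^\top+U_t\Delta V^\top+\Delta U V_t^\top)B^\top]-Y\|_F^2,$$ the one with minimal $\|\Delta U\|_F^2+\|\Delta V\|_F^2$; then set $U_{t+1}=U_t+\Delta U_{t+1}$, $V_{t+1}=V_t+\Delta V_{t+1}$. *)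

(* Defs.v *)
From HB Require Import structures.
From mathcomp Require Import all_boot all_order all_algebra.
From mathcomp Require Import boolp reals exp.
Set Implicit Arguments. Unset Strict Implicit. Unset Printing Implicit Defensive.
Import Order.TTheory GRing.Theory Num.Theory.
Local Open Scope ring_scope.

Section Defs.
Variable R : realType.

Definition frob m n (X : 'M[R]_(m, n)) : R :=
  Num.sqrt (\sum_(i < m) \sum_(j < n) X i j ^+ 2).

Definition rownorm m n (X : 'M[R]_(m, n)) (i : 'I_m) : R :=
  Num.sqrt (\sum_(j < n) X i j ^+ 2).

Definition norm2inf_le m n (X : 'M[R]_(m, n)) (b : R) : Prop :=
  forall i, rownorm X i <= b.

Definition is_isometry m n (A : 'M[R]_(m, n)) : Prop := A^T *m A = 1%:M.

(* s is the k-th (1-based) largest singular value of X: X = P S Q^T with P, Q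
   orthogonal, S rectangular diagonal with nonnegative nonincreasing diagonal. *)
Definition is_singular_value m n (X : 'M[R]_(m, n)) (k : nat) (s : R) : Prop :=
  exists (P : 'M[R]_m) (Q : 'M[R]_n) (d : nat -> R),
    P^T *m P = 1%:M /\ Q^T *m Q = 1%:M /\
    (forall i : nat, (i < minn m n)%N -> 0 <= d i) /\
    (forall i j : nat, (i <= j)%N -> (j < minn m n)%N -> d j <= d i) /\
    X = P *m (\matrix_(i < m, j < n) (if (i == j :> nat) then d i else 0)) *m Q^T /\
    s = d k.-1.

Definition POmega m n (Om : {set 'I_m * 'I_n}) (X : 'M[R]_(m, n)) : 'M[R]_(m, n) :=
  \matrix_(i, j) if (i, j) \in Om then X i j else 0.

Definition gn_obj n1 n2 d1 d2 r (A : 'M[R]_(n1, d1)) (B : 'M[R]_(n2, d2))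
  (Om : {set 'I_n1 * 'I_n2}) (Y : 'M[R]_(n1, n2))
  (U : 'M[R]_(d1, r)) (V : 'M[R]_(d2, r)) (dU : 'M[R]_(d1, r)) (dV : 'M[R]_(d2, r)) : R :=
  frob (POmega Om (A *m (U *m V^T + U *m dV^T + dU *m V^T) *m B^T) - Y) ^+ 2.

Definition gnimc_step n1 n2 d1 d2 r (A : 'M[R]_(n1, d1)) (B : 'M[R]_(n2, d2))
  (Om : {set 'I_n1 * 'I_n2}) (Y : 'M[R]_(n1, n2))
  (U : 'M[R]_(d1, r)) (V : 'M[R]_(d2, r)) (dU : 'M[R]_(d1, r)) (dV : 'M[R]_(d2, r)) : Prop :=
  (forall dU' dV', gn_obj A B Om Y U V dU dV <= gn_obj A B Om Y U V dU' dV') /\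
  (forall dU' dV', gn_obj A B Om Y U V dU' dV' <= gn_obj A B Om Y U V dU dV ->
     frob dU ^+ 2 + frob dV ^+ 2 <= frob dU' ^+ 2 + frob dV' ^+ 2).

Definition gnimc_iterates n1 n2 d1 d2 r (A : 'M[R]_(n1, d1)) (B : 'M[R]_(n2, d2))
  (Om : {set 'I_n1 * 'I_n2}) (Y : 'M[R]_(n1, n2))
  (U : nat -> 'M[R]_(d1, r)) (V : nat -> 'M[R]_(d2, r)) : Prop :=
  forall t, gnimc_step A B Om Y (U t) (V t) (U t.+1 - U t) (V t.+1 - V t).

Definition prob_unif_subsets n1 n2 (k : nat) (E : {set 'I_n1 * 'I_n2} -> Prop) : R :=
  (#|[set Om : {set 'I_n1 * 'I_n2} | (#|Om| == k) && `[< E Om >]]|%:R)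
  / (#|[set Om : {set 'I_n1 * 'I_n2} | #|Om| == k]|%:R).

End Defs.
Arguments prob_unif_subsets {R n1 n2}.

(* Main.v *)
Require Import Defs.
From HB Require Import structures.
From mathcomp Require Import all_boot all_order all_algebra.
From mathcomp Require Import boolp reals sequences exp.
From mathcomp Require Import ring lra.
Import Order.TTheory GRing.Theory Num.Theory.
Local Open Scope ring_scope.

(** Sampling.  The vectors v_ij = a_i (x) b_j form a tight frame, and the squared
    norm of the observed part of A X B^T is <M X, X> for M the sum of v v^T over Omega.
    With eta = 1/(K L), where L bounds |v|^2 and K is large, the potentials
    tr (1 + eta M)^K and tr (1 - eta M)^K replace the matrix exponentials of the
    matrix Chernoff bound: for a rank-one increment, expanding the power and using
    the Chebyshev inequality c_i c_k <= c_0 c_(i+k) for the moments c_i = v^T C^i v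
    of a positive matrix C controls the next potential, with no spectral theorem
    and no Golden-Thompson inequality.  Drawing Omega one element at a time, the
    average over the unused indices of v^T C^i v is governed by tr (C^i (1 - M)).
    Hence X |-> P_Omega(A X B^T) has condition number at most sqrt 1280 < 36 on all
    of the d1 x d2 matrices, with the required probability.

    Convergence.  The component of Z (where X^* = A Z B^T) normal to the column
    spaces of U and of V has norm at most e^2/sigma, e being the current error, so
    the least-squares residual is at most 36 e^2/sigma.  Minimality of the norm
    forces U^T dU = dV^T V; therefore the two parts of the linearized update have
    nonnegative inner product, |dU|^2 + |dV|^2 = O(e^2/sigma), and U^T U - V^T V
    changes by at most that much.  The balance is thus kept along the iteration, and
    it is what bounds the singular values of U and V from below. *)

Set Implicit Arguments. Unset Strict Implicit. Unset Printing Implicit Defensive.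

(** * Positive matrices and their moments *)

Section TraceForm.
Variable R : realFieldType.

(** The discriminant inequality with no sign assumption on [d]: the cases [d < 0], and [d = 0] with
    [b] nonzero, are excluded by explicit points where the quadratic is negative. *)
Lemma sqr_le_of_quadratic_ge0 (a b d : R) :
  (forall s : R, 0 <= a + 2 * s * b + s ^+ 2 * d) -> b ^+ 2 <= a * d.
Proof.
move=> H.
have a0 : 0 <= a by have := H 0; rewrite mulr0 mul0r expr0n mul0r !addr0.
have [dz|d0] := eqVneq d 0.
  rewrite {}dz in H *.
  have [->|b0] := eqVneq b 0; first by rewrite expr0n mulr0.
  have := H (- (a + 1) / (2 * b)); rewrite leNgt => /negP[].
  rewrite mulr0 addr0.
  have -> : 2 * (- (a + 1) / (2 * b)) * b = - (a + 1) by field.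
  lra.
have := H (- (b / d)).
have -> : a + 2 * - (b / d) * b + (- (b / d)) ^+ 2 * d = a - b ^+ 2 / d by field.
rewrite subr_ge0 => h.
have dpos : 0 < d.
  rewrite lt_neqAle eq_sym d0 leNgt; apply/negP => dneg.
  (* The terms in [b] cancel between the values at [s] and [- s], whose sum
     [2 * a + 2 * s * (d - a)] is negative because [s >= 1]. *)
  set s := 1 + a / - d.
  have s1 : 1 <= s by rewrite lerDl divr_ge0 // oppr_ge0 ltW.
  have sd : s * d = d - a by rewrite /s; field.
  have := H s; have := H (- s).
  have -> : (- s) ^+ 2 * d = s * (s * d) by ring.
  have -> : s ^+ 2 * d = s * (s * d) by ring.
  rewrite sd; nra.
by rewrite -ler_pdivrMr.
Qed.

Definition mxform n (C : 'M[R]_n) k (X Y : 'M[R]_(n, k)) : R :=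
  \tr (X^T *m C *m Y).

(** Testing the form on matrices of every width covers vectors and also [X = 1], which yields
    nonnegativity of the trace at once. *)
Definition psdmx n (C : 'M[R]_n) : Prop :=
  C^T = C /\ forall k (X : 'M[R]_(n, k)), 0 <= mxform C X X.

Lemma mxformC n (C : 'M[R]_n) k (X Y : 'M[R]_(n, k)) :
  C^T = C -> mxform C X Y = mxform C Y X.
Proof.
by move=> CT; rewrite /mxform -mxtrace_tr !trmx_mul trmxK CT mulmxA.
Qed.

Lemma psd_cauchy n (C : 'M[R]_n) k (X Y : 'M[R]_(n, k)) : psdmx C ->
  mxform C X Y ^+ 2 <= mxform C X X * mxform C Y Y.
Proof.
move=> [CT pC]; apply: sqr_le_of_quadratic_ge0 => s.
have := pC k (X + s *: Y).
rewrite {1}/mxform !mulmxDr ![(_ + _)^T]raddfD /= !mulmxDl ![(_ *: _)^T]linearZ /=.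
rewrite -!scalemxAl -!scalemxAr !mxtraceD !mxtraceZ.
rewrite -!/(mxform _ _ _) (mxformC Y X CT).
by congr (0 <= _); ring.
Qed.

Lemma mxform1 n k (X Y : 'M[R]_(n, k)) : mxform 1%:M X Y = \tr (X^T *m Y).
Proof. by rewrite /mxform mulmx1. Qed.

Lemma mxtrace_sqr m n (X : 'M[R]_(m, n)) :
  \tr (X^T *m X) = \sum_i \sum_j X i j ^+ 2.
Proof.
rewrite exchange_big /mxtrace; apply: eq_bigr => j _; rewrite mxE.
by apply: eq_bigr => i _; rewrite mxE expr2.
Qed.

Lemma mxtrace_sqr_ge0 m n (X : 'M[R]_(m, n)) : 0 <= \tr (X^T *m X).
Proof.
by rewrite mxtrace_sqr; do 2![apply: sumr_ge0 => ? _]; rewrite sqr_ge0.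
Qed.

Lemma psdmx1 n : psdmx (1 : 'M[R]_n).
Proof.
split; first exact: trmx1.
by move=> k X; rewrite mxform1 mxtrace_sqr_ge0.
Qed.

Lemma psdmxD n (C1 C2 : 'M[R]_n) : psdmx C1 -> psdmx C2 -> psdmx (C1 + C2).
Proof.
move=> [T1 p1] [T2 p2]; split=> [|k X]; first by rewrite linearD /= T1 T2.
by rewrite /mxform mulmxDr mulmxDl linearD /= addr_ge0 // ?p1 ?p2.
Qed.

Lemma psdmxZ n (a : R) (C : 'M[R]_n) : 0 <= a -> psdmx C -> psdmx (a *: C).
Proof.
move=> a0 [T1 p1]; split=> [|k X]; first by rewrite linearZ /= T1.
by rewrite /mxform -scalemxAr -scalemxAl linearZ /= mulr_ge0 // p1.
Qed.

Lemma psdmx0 n : psdmx (0 : 'M[R]_n).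
Proof.
by split=> [|k X]; rewrite ?trmx0 // /mxform mulmx0 mul0mx mxtrace0.
Qed.

Lemma psdmx_sum n (I : finType) (P : pred I) (F : I -> 'M[R]_n) :
  (forall i, P i -> psdmx (F i)) -> psdmx (\sum_(i | P i) F i).
Proof. by move=> H; elim/big_ind: _ => //; [exact: psdmx0|exact: psdmxD]. Qed.

Lemma psdmx_gram n k (v : 'M[R]_(n, k)) : psdmx (v *m v^T).
Proof.
split=> [|l X]; first by rewrite trmx_mul trmxK.
rewrite /mxform.
have -> : X^T *m (v *m v^T) *m X = (v^T *m X)^T *m (v^T *m X).
  by rewrite trmx_mul trmxK !mulmxA.
exact: mxtrace_sqr_ge0.
Qed.

Lemma trmxX n (C : 'M[R]_n) j : C^T = C -> (C ^+ j)^T = C ^+ j.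
Proof.
move=> CT; elim: j => [|j IH]; first exact: trmx1.
by rewrite [in LHS]exprSr trmx_mul IH CT exprS.
Qed.

(** By commutation the product is the congruence [C^j E C^j]. *)
Lemma psdmxM_evenX n (C E : 'M[R]_n) j : C^T = C -> GRing.comm E C -> psdmx E ->
  psdmx (E * C ^+ j.*2).
Proof.
move=> CT cEC [ET pE].
have cj : GRing.comm E (C ^+ j) by apply: commrX.
have e : E * C ^+ j.*2 = C ^+ j * E * C ^+ j.
  by rewrite -addnn exprD mulrA cj.
rewrite e; split=> [|k X].
  by rewrite !trmx_mul trmxX // ET mulmxA.
have := pE k (C ^+ j *m X); rewrite /mxform trmx_mul trmxX // !mulmxA.
by rewrite -!mulmxA.
Qed.

Lemma psdmxX n (C : 'M[R]_n) j : psdmx C -> psdmx (C ^+ j).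
Proof.
move=> [CT pC]; rewrite -(odd_double_half j) exprD.
case: (odd j); rewrite ?expr1 ?expr0; apply: psdmxM_evenX => //; last exact: psdmx1.
by rewrite /GRing.comm mul1r mulr1.
Qed.

(** An odd power is treated as [E * C] times an even one, so that positivity has to be checked by
    hand only for [E * C], without square roots. *)
Lemma psdmxMX n (C E : 'M[R]_n) j : psdmx C -> psdmx (E * C) ->
  GRing.comm E C -> psdmx E -> psdmx (E * C ^+ j).
Proof.
move=> [CT pC] EC cEC pE; rewrite -(odd_double_half j) exprD.
case: (odd j); rewrite ?expr1 ?expr0 ?mul1r; last exact: psdmxM_evenX.
rewrite mulrA; apply: psdmxM_evenX => //.
by rewrite /GRing.comm mulrA -cEC.
Qed.

Lemma psd_trace n (C : 'M[R]_n) : psdmx C -> 0 <= \tr C.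
Proof. by move=> [_ /(_ n 1%:M)]; rewrite /mxform trmx1 mul1mx mulmx1. Qed.

(* Moments of a psd matrix are log-convex, by Cauchy-Schwarz for the form C or
   for the identity according to parity. *)
Lemma mxform_logconvex n (C : 'M[R]_n) k (X : 'M[R]_(n, k)) i : psdmx C ->
  mxform (C ^+ i.+1) X X ^+ 2 <= mxform (C ^+ i) X X * mxform (C ^+ i.+2) X X.
Proof.
move=> pC; have [CT _] := pC.
set E := if odd i then C else 1.
have pE : psdmx E by rewrite /E; case: odd => //; exact: psdmx1.
have cE j : C ^+ j * E = E * C ^+ j.
  rewrite /E; case: odd; last by rewrite mul1r mulr1.
  by rewrite -exprSr -exprS.
have H a b : mxform E (C ^+ a *m X) (C ^+ b *m X) = mxform (E * C ^+ (a + b)) X X.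
  rewrite /mxform trmx_mul trmxX // exprD !mulrA -cE; congr (\tr _).
  by rewrite -!mulmxA.
have Ei j : E * C ^+ (i./2.*2 + j) = C ^+ (i + j).
  rewrite -[in RHS](odd_double_half i) /E; case: odd => /=.
    by rewrite -exprS.
  by rewrite mul1r.
have := @psd_cauchy n E k (C ^+ i./2 *m X) (C ^+ i./2.+1 *m X) pE.
rewrite !H; set h := i./2 in Ei *.
have -> : (h + h = h.*2 + 0)%N by rewrite addn0 addnn.
have -> : (h + h.+1 = h.*2 + 1)%N by rewrite addnS addnn addn1.
have -> : (h.+1 + h.+1 = h.*2 + 2)%N by rewrite addnS addSn addnn addn2.
by rewrite !Ei addn0 addn1 addn2.
Qed.

(** Log-convexity makes the ratios [c i.+1 / c i] nondecreasing, so a product of two terms can only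
    grow when their indices are spread apart, until one index is 0. *)
Lemma chebyshev_logconvex (c : nat -> R) :
  (forall i, 0 <= c i) -> (forall i, c i.+1 ^+ 2 <= c i * c i.+2) ->
  forall i k, c i * c k <= c 0%N * c (i + k)%N.
Proof.
move=> c0 cc.
(* Monotonicity of the ratios, cross-multiplied because terms may vanish. *)
have P i k : (i <= k)%N -> c i.+1 * c k <= c i * c k.+1.
  elim: k => [|k IH]; first by rewrite leqn0 => /eqP ->; rewrite mulrC.
  rewrite leq_eqVlt => /orP[/eqP ->|/IH {}IH]; first by rewrite mulrC.
  have [->|nz] := eqVneq (c k.+1) 0; first by rewrite mulr0 mulr_ge0.
  have kp : 0 < c k.+1 by rewrite lt_neqAle eq_sym nz c0.
  have := cc k; have := c0 k; have := c0 k.+2; have := c0 i; have := c0 i.+1.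
  move=> h1 h2 h3 h4 h5.
  have ckp : 0 < c k.
    rewrite lt_neqAle eq_sym h4 andbT; apply/eqP => z.
    by move: h5; rewrite z mul0r leNgt exprn_gt0.
  rewrite -(ler_pM2r ckp).
  have := ler_wpM2r (ltW kp) IH; have := ler_wpM2l h2 h5; nra.
have Q i k : (i <= k)%N -> c i * c k <= c 0%N * c (i + k)%N.
  elim: i k => [|i IH] k ik; first by rewrite add0n.
  apply: le_trans (P _ _ (ltnW ik)) _.
  by rewrite addSnnS IH // (leq_trans _ (leqnSn _)) // ltnW.
move=> i k; case: (leqP i k) => [/Q //|/ltnW /Q]; by rewrite mulrC addnC.
Qed.

Lemma psd_chebyshev n (C : 'M[R]_n) k (X : 'M[R]_(n, k)) i j : psdmx C ->
  mxform (C ^+ i) X X * mxform (C ^+ j) X X <=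
    \tr (X^T *m X) * mxform (C ^+ (i + j)) X X.
Proof.
move=> pC; rewrite -mxform1.
apply: (chebyshev_logconvex (c := fun i => mxform (C ^+ i) X X)).
  by move=> l; have [_] := psdmxX l pC; apply.
by move=> l; exact: mxform_logconvex.
Qed.

(** Chebyshev with first exponent 1 reads [c_1 c_K <= c_(K+1)] for a normalized [X]; induction on
    [K] concludes. *)
Lemma psd_jensen n (C : 'M[R]_n) k (X : 'M[R]_(n, k)) K : psdmx C ->
  \tr (X^T *m X) = 1 -> mxform C X X ^+ K <= mxform (C ^+ K) X X.
Proof.
move=> pC X1; elim: K => [|K IH]; first by rewrite !expr0 mxform1 X1.
have := psd_chebyshev X 1 K pC; rewrite X1 mul1r expr1 add1n => h.
by apply: le_trans h; rewrite exprS ler_wpM2l //; case: pC => _; apply.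
Qed.

(* Evaluating the form C on the columns of 1 - u u^T avoids the square root of C. *)
Lemma psd_form_le_trace n (C : 'M[R]_n) (u : 'cV[R]_n) : psdmx C ->
  \tr (u^T *m u) = 1 -> mxform C u u <= \tr C.
Proof.
move=> [CT pC] u1.
have uu : u^T *m u = 1%:M.
  by rewrite [LHS]mx11_scalar; congr (_%:M); rewrite -u1 /mxtrace big_ord1.
have := pC n (1%:M - u *m u^T).
rewrite /mxform [(_ - _)^T]raddfB /= trmx1 trmx_mul trmxK !mulmxBl !mul1mx !mulmxBr !mulmx1.
have -> : u *m u^T *m C *m (u *m u^T) = u *m (u^T *m C *m u) *m u^T.
  by rewrite !mulmxA.
have t1 : \tr (C *m (u *m u^T)) = \tr (u^T *m C *m u).
  by rewrite mulmxA mxtrace_mulC mulmxA.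
have t2 : \tr (u *m (u^T *m C *m u) *m u^T) = \tr (u^T *m C *m u).
  by rewrite mxtrace_mulC (mulmxA u^T u) uu mul1mx.
rewrite !raddfB /= t2 [\tr (u *m u^T *m C)]mxtrace_mulC t1; lra.
Qed.
End TraceForm.

(** * Rank-one updates *)

Section RankOneUpdate.
Variable R : realFieldType.

Lemma mxtrace_mul11 (a b : 'M[R]_1) : \tr (a *m b) = \tr a * \tr b.
Proof. by rewrite /mxtrace !big_ord1 mxE big_ord1. Qed.

Lemma mxformD n (C E : 'M[R]_n) k (X : 'M[R]_(n, k)) :
  mxform (C + E) X X = mxform C X X + mxform E X X.
Proof. by rewrite /mxform mulmxDr mulmxDl mxtraceD. Qed.

Lemma mxformZ n (a : R) (C : 'M[R]_n) k (X : 'M[R]_(n, k)) :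
  mxform (a *: C) X X = a * mxform C X X.
Proof. by rewrite /mxform -scalemxAr -scalemxAl mxtraceZ. Qed.

Lemma mxform_ge0 n (C : 'M[R]_n) k (X : 'M[R]_(n, k)) :
  psdmx C -> 0 <= mxform C X X.
Proof. by case=> _; apply. Qed.

Lemma mxform_gram_mul n (C E : 'M[R]_n) (v : 'cV[R]_n) :
  mxform (C * (v *m v^T) * E) v v = mxform C v v * mxform E v v.
Proof.
rewrite /mxform -mxtrace_mul11; congr (\tr _).
by rewrite -!mulmxE !mulmxA.
Qed.

(** Only the last factor [S] is expanded: its rank-one part splits the form at [v] into a product of
    two moments. *)
Lemma rank_one_recurrence n (C : 'M[R]_n) (v : 'cV[R]_n) (eta : R) i j :
  let S := C + eta *: (v *m v^T) in
  mxform (S ^+ j.+1 * C ^+ i) v v =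
    mxform (S ^+ j * C ^+ i.+1) v v + eta * (mxform (S ^+ j) v v * mxform (C ^+ i) v v).
Proof.
move=> S; rewrite -mxform_gram_mul -mxformZ -mxformD; congr (mxform _ v v).
rewrite exprSr exprS {2}/S mulrDr mulrDl -mulrA; congr (_ + _).
by rewrite -!mulmxE -scalemxAr -scalemxAl.
Qed.

Section Update.
Variables (n : nat) (C : 'M[R]_n) (v : 'cV[R]_n) (eta : R).
Hypotheses (psdC : psdmx C) (eta_ge0 : 0 <= eta).
Let S := C + eta *: (v *m v^T).

Let psdS : psdmx S.
Proof. by apply: psdmxD => //; apply: psdmxZ => //; exact: psdmx_gram. Qed.

Lemma rank_one_moment_ge i j :
  mxform (C ^+ (i + j)) v v <= mxform (S ^+ j * C ^+ i) v v.
Proof.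
elim: j i => [|j IH] i; first by rewrite addn0 expr0 mul1r.
rewrite rank_one_recurrence -/S addnS -addSn.
by rewrite (le_trans (IH _)) // lerDl !mulr_ge0 // mxform_ge0 //; exact: psdmxX.
Qed.

(** In the recurrence, Chebyshev merges the product of moments into [|v|^2] times a single moment,
    whose exponent the hypothesis raises at the price [1 / b]. Trading one factor [S] for [C] thus
    costs [1 + eta * |v|^2 / b]. *)
Lemma rank_one_moment_le (b : R) i j : 0 < b ->
  (forall k, b * mxform (C ^+ k) v v <= mxform (C ^+ k.+1) v v) ->
  mxform (S ^+ j * C ^+ i) v v <=
    (1 + eta * \tr (v^T *m v) / b) ^+ j * mxform (C ^+ (i + j)) v v.
Proof.
move=> b0 bC; set h := eta * _ / b.
have h0 : 0 <= h by rewrite divr_ge0 ?mulr_ge0 ?mxtrace_sqr_ge0 // ltW.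
elim: j i => [|j IH] i; first by rewrite addn0 !expr0 !mul1r.
rewrite rank_one_recurrence -/S.
have := IH i.+1; have := IH 0%N; rewrite expr0 mulr1 add0n => I1 I2.
have c0 k : 0 <= mxform (C ^+ k) v v by apply: mxform_ge0; exact: psdmxX.
have step : mxform (S ^+ j) v v * mxform (C ^+ i) v v <=
    (1 + h) ^+ j * (\tr (v^T *m v) * mxform (C ^+ (i + j)) v v).
  apply: le_trans (ler_wpM2r (c0 i) I1) _; rewrite -mulrA.
  by rewrite ler_wpM2l ?exprn_ge0 ?addr_ge0 // addnC; exact: psd_chebyshev.
apply: le_trans (lerD I2 (ler_wpM2l eta_ge0 step)) _.
have -> : eta * ((1 + h) ^+ j * (\tr (v^T *m v) * mxform (C ^+ (i + j)) v v)) =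
  (1 + h) ^+ j * (h * (b * mxform (C ^+ (i + j)) v v)).
  by rewrite /h; field; rewrite gt_eqF.
rewrite -mulrDr exprSr -mulrA ler_wpM2l ?exprn_ge0 ?addr_ge0 //.
rewrite addSn -addnS -[X in X <= _]addr0 addnS mulrDl mul1r addr0.
by rewrite lerD2l ler_wpM2l.
Qed.

(** Noncommutative telescoping of [S^K - C^K]; cyclicity of the trace and symmetry turn each term
    into a mixed moment. *)
Lemma rank_one_traceB K :
  \tr (S ^+ K) - \tr (C ^+ K) =
    eta * \sum_(j < K) mxform (S ^+ j * C ^+ (K.-1 - j)) v v.
Proof.
have tel : S ^+ K - C ^+ K =
    \sum_(j < K) S ^+ j * (eta *: (v *m v^T)) * C ^+ (K.-1 - j).
  have dS : eta *: (v *m v^T) = S - C by rewrite /S addrC addKr.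
  rewrite dS; case: K => [|K]; first by rewrite big_ord0 subrr.
  have T k : (k <= K.+1)%N ->
     S ^+ k * C ^+ (K.+1 - k) - C ^+ K.+1 =
     \sum_(j < k) S ^+ j * (S - C) * C ^+ (K - j).
    elim: k => [|k IH] kK; first by rewrite big_ord0 expr0 mul1r subn0 subrr.
    rewrite big_ord_recr /= -IH ?(ltnW kK) // mulrBr mulrBl -exprSr.
    rewrite subSS -[in RHS]mulrA -exprS -subSn //.
    by rewrite [LHS]addrC [in RHS]addrC addrA subrK addrC.
  by rewrite -T // subnn expr0 mulr1.
rewrite -raddfB /= tel raddf_sum mulr_sumr; apply: eq_bigr => j _ /=.
rewrite -!mulmxE -scalemxAr -scalemxAl mxtraceZ; congr (_ * _).
have CT : (C ^+ (K.-1 - j))^T = C ^+ (K.-1 - j) by apply: trmxX; case: psdC.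
have ST : (S ^+ j)^T = S ^+ j by apply: trmxX; case: psdS.
rewrite /mxform -[RHS]mxtrace_tr !trmx_mul CT ST trmxK.
have -> : S ^+ j *m (v *m v^T) *m C ^+ (K.-1 - j) =
  (S ^+ j *m v) *m (v^T *m C ^+ (K.-1 - j)) by rewrite !mulmxA.
by rewrite mxtrace_mulC !mulmxA.
Qed.

Lemma rank_one_trace_ge K :
  \tr (C ^+ K) + eta * K%:R * mxform (C ^+ K.-1) v v <= \tr (S ^+ K).
Proof.
rewrite -lerBrDl rank_one_traceB -mulrA ler_wpM2l //.
rewrite -[K in K%:R]card_ord mulr_natl -sumr_const; apply: ler_sum => j _.
have := rank_one_moment_ge (K.-1 - j) j; rewrite subnK //.
by have := ltn_ord j; case: (K) j.
Qed.

Lemma rank_one_trace_le (b : R) K : 0 < b ->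
  (forall k, b * mxform (C ^+ k) v v <= mxform (C ^+ k.+1) v v) ->
  \tr (S ^+ K) <= \tr (C ^+ K) +
    eta * K%:R * ((1 + eta * \tr (v^T *m v) / b) ^+ K * mxform (C ^+ K.-1) v v).
Proof.
move=> b0 bC.
rewrite -lerBlDl rank_one_traceB -mulrA ler_wpM2l //.
rewrite -[K in K%:R]card_ord mulr_natl -sumr_const; apply: ler_sum => j _.
have := rank_one_moment_le (K.-1 - j) j b0 bC; rewrite subnK; last first.
  by have := ltn_ord j; case: (K) j.
move=> h; apply: le_trans h _.
rewrite ler_wpM2r ?mxform_ge0 //; first exact: psdmxX.
rewrite ler_weXn2l ?lerDl //; last exact: ltnW.
by rewrite divr_ge0 ?mulr_ge0 ?mxtrace_sqr_ge0 // ltW.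
Qed.

End Update.
End RankOneUpdate.

(** * Potentials under sampling without replacement *)

Section SubsetAverage.
Variables (R : realFieldType) (T : finType).
Implicit Types (f g : {set T} -> R) (Om : {set T}).

(** Double counting of the pairs formed by a subset of size [t.+1] and one of its elements. *)
Lemma sum_subsets_step f t :
  t.+1%:R * \sum_(Om : {set T} | #|Om| == t.+1) f Om =
  \sum_(Om : {set T} | #|Om| == t) \sum_(k | k \notin Om) f (k |: Om).
Proof.
rewrite mulr_sumr.
transitivity (\sum_(Om : {set T} | #|Om| == t.+1) \sum_(k | k \in Om) f Om).
  by apply: eq_bigr => Om /eqP <-; rewrite sumr_const mulr_natl.
rewrite (exchange_big_dep predT) //= [RHS](exchange_big_dep predT) //=.
apply: eq_bigr => k _.
rewrite (reindex_onto (fun Om => k |: Om) (fun Om => Om :\ k)) /=; last first.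
  by move=> Om /andP[_ kO]; rewrite setD1K.
apply: eq_bigl => Om; rewrite setU11 andbT.
have [kO|kO] := boolP (k \in Om).
  rewrite andbF; apply/negP => /andP[_ /eqP E].
  by move: kO; rewrite -E !inE eqxx.
by rewrite setU1K // eqxx cardsU1 kO /= add1n eqSS.
Qed.

Definition subset_avg t f : R :=
  (\sum_(Om : {set T} | #|Om| == t) f Om) / 'C(#|T|, t)%:R.

Lemma subset_avg_step f t : (t < #|T|)%N ->
  subset_avg t.+1 f =
    subset_avg t (fun Om => (\sum_(k | k \notin Om) f (k |: Om)) / (#|T| - t)%:R).
Proof.
move=> tT; rewrite /subset_avg -mulr_suml -sum_subsets_step.
have := mul_bin_left #|T| t; move/(congr1 (fun n => n%:R : R)); rewrite !natrM => e.
have b1 : 'C(#|T|, t)%:R != 0 :> R by rewrite pnatr_eq0 -lt0n bin_gt0 ltnW.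
have b3 : (#|T| - t)%:R != 0 :> R by rewrite pnatr_eq0 -lt0n subn_gt0.
have -> : 'C(#|T|, t.+1)%:R = (#|T| - t)%:R * 'C(#|T|, t)%:R / t.+1%:R :> R.
  by rewrite -e mulrC mulKf // pnatr_eq0.
set S := \sum_(_ | _) _; set a := (#|T| - t)%:R in b3 *.
have t0 : t.+1%:R != 0 :> R by rewrite pnatr_eq0.
by move: b1 b3 t0; move: (t.+1%:R) => c *; field; apply/and3P.
Qed.

Lemma le_subset_avg t f g : (forall Om, #|Om| = t -> f Om <= g Om) ->
  subset_avg t f <= subset_avg t g.
Proof.
move=> fg; rewrite ler_wpM2r ?invr_ge0 ?ler0n //.
by apply: ler_sum => Om /eqP; exact: fg.
Qed.

Lemma subset_avg_affine t (a b : R) f : (t <= #|T|)%N ->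
  subset_avg t (fun Om => a * f Om + b) = a * subset_avg t f + b.
Proof.
move=> tT; rewrite /subset_avg big_split /= -mulr_sumr sumr_const.
have -> : #|[pred Om : {set T} | #|Om| == t]| = 'C(#|T|, t).
  by rewrite -card_draws cardsE.
have b1 : 'C(#|T|, t)%:R != 0 :> R by rewrite pnatr_eq0 -lt0n bin_gt0.
by rewrite mulrDl -mulrA -[b *+ _]mulr_natr mulfK.
Qed.

Lemma subset_avg0 f : subset_avg 0 f = f set0.
Proof.
rewrite /subset_avg bin0 divr1 (bigD1 set0) ?cards0 //= big1 ?addr0 // => Om.
by rewrite cards_eq0 => /andP[/eqP ->]; rewrite eqxx.
Qed.

Lemma subset_markov t f (P : pred {set T}) (c : R) : 0 < c ->
  (forall Om, 0 <= f Om) -> (forall Om, P Om -> c <= f Om) ->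
  #|[set Om : {set T} | (#|Om| == t) && P Om]|%:R / 'C(#|T|, t)%:R <=
    subset_avg t f / c.
Proof.
move=> c0 f0 fP; rewrite /subset_avg mulrAC ler_wpM2r ?invr_ge0 ?ler0n //.
rewrite ler_pdivlMr // mulr_natl -sumr_const.
rewrite (eq_bigl (fun Om : {set T} => (#|Om| == t) && P Om)); last by move=> ?; rewrite inE.
rewrite [leRHS](bigID P) /= -[leLHS]addr0 lerD ?sumr_ge0 //.
by apply: ler_sum => Om /andP[_ /fP].
Qed.
End SubsetAverage.

Section Sampling.
Variables (R : realFieldType) (T : finType) (D : nat) (v : T -> 'cV[R]_D).
Implicit Types (Om : {set T}) (k : T).
Hypothesis tight : \sum_k v k *m (v k)^T = 1.

Definition frame_op (Om : {set T}) : 'M[R]_D := \sum_(k in Om) v k *m (v k)^T.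
Local Notation M := frame_op.

Lemma frame_opU1 Om k : k \notin Om -> M (k |: Om) = M Om + v k *m (v k)^T.
Proof. by move=> kO; rewrite /M big_setU1 //= addrC. Qed.

Lemma frame_opC Om : 1 - M Om = \sum_(k | k \notin Om) v k *m (v k)^T.
Proof. by rewrite -tight (bigID (mem Om)) /= addrAC subrr add0r. Qed.

Lemma frame_op_psd Om : psdmx (M Om).
Proof. by apply: psdmx_sum => k _; exact: psdmx_gram. Qed.

Lemma frame_opC_psd Om : psdmx (1 - M Om).
Proof. by rewrite frame_opC; apply: psdmx_sum => k _; exact: psdmx_gram. Qed.

Lemma sum_mxform_frame (E : 'M[R]_D) Om :
  \sum_(k | k \notin Om) mxform E (v k) (v k) = \tr (E * (1 - M Om)).
Proof.
rewrite frame_opC mulr_sumr raddf_sum /=; apply: eq_bigr => k _.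
by rewrite /mxform -mulmxE mulmxA [RHS]mxtrace_mulC mulmxA.
Qed.

Variable L : R.
Hypothesis L_ge0 : 0 <= L.
Hypothesis short : forall k, \tr ((v k)^T *m v k) <= L.

(** * The potential that controls the largest eigenvalue *)

Section Upper.
Variables (eta : R) (K : nat).
Hypothesis eta_ge0 : 0 <= eta.
Let C Om : 'M[R]_D := 1 + eta *: M Om.

Lemma upper_op_psd Om : psdmx (1 + eta *: M Om).
Proof.
apply: psdmxD; first exact: psdmx1.
by apply: psdmxZ => //; exact: frame_op_psd.
Qed.

Let psdC Om : psdmx (C Om) := upper_op_psd Om.

Let psdMC Om j : psdmx (M Om * C Om ^+ j).
Proof.
have pM := frame_op_psd Om.
have comMC : GRing.comm (M Om) (C Om).
  rewrite /GRing.comm mulrDr mulrDl mulr1 mul1r.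
  by rewrite -!mulmxE -scalemxAl -scalemxAr.
apply: psdmxMX => //; rewrite /C mulrDr mulr1 -mulmxE -scalemxAr.
by apply: psdmxD => //; apply: psdmxZ => //; exact: (psdmxX 2 pM).
Qed.

Let CS Om j : C Om ^+ j.+1 = C Om ^+ j + eta *: (M Om * C Om ^+ j).
Proof. by rewrite exprS {1}/C mulrDl mul1r -!mulmxE -scalemxAl. Qed.

Definition upper_potential Om := \tr ((1 + eta *: M Om) ^+ K).

Lemma upper_potential_ge0 Om : 0 <= upper_potential Om.
Proof. by apply: psd_trace; apply: psdmxX; exact: psdC. Qed.

Lemma upper_potential_step Om :
  \sum_(k | k \notin Om) upper_potential (k |: Om) <=
   ((#|T| - #|Om|)%:R + eta * K%:R * (1 + eta * L) ^+ K) * upper_potential Om.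
Proof.
set G := eta * K%:R * _.
have step k : k \notin Om -> upper_potential (k |: Om) <=
    upper_potential Om + G * mxform (C Om ^+ K.-1) (v k) (v k).
  move=> kO.
  rewrite /upper_potential frame_opU1 // scalerDr addrA.
  (* The floor is [b = 1], since [C Om] dominates the identity. *)
  apply: le_trans (@rank_one_trace_le _ _ (C Om) (v k) eta (psdC Om) eta_ge0 1 K ltr01 _) _.
    move=> j; rewrite mul1r CS mxformD mxformZ lerDl mulr_ge0 //.
    exact: mxform_ge0.
  rewrite lerD2l divr1 -!mulrA; do 2![rewrite ler_wpM2l //].
  rewrite ler_wpM2r ?mxform_ge0 //; first exact: psdmxX.
  have tr0 := mxtrace_sqr_ge0 (v k).
  by rewrite lerXn2r ?nnegrE ?addr_ge0 ?mulr_ge0 // lerD2l ler_wpM2l.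
apply: le_trans (ler_sum _ step) _.
rewrite big_split /= sumr_const -mulr_sumr sum_mxform_frame mulrDl.
have -> : #|[pred k | k \notin Om]| = (#|T| - #|Om|)%N.
  by rewrite -(cardC (mem Om)) addKn; apply: eq_card.
rewrite mulr_natl lerD2l.
rewrite ler_wpM2l //.
  by rewrite !mulr_ge0 // exprn_ge0 // addr_ge0 // mulr_ge0.
have tr0 j : 0 <= \tr (M Om * C Om ^+ j) by apply: psd_trace; exact: psdMC.
have comMC j : C Om ^+ j * M Om = M Om * C Om ^+ j.
  apply/esym/commrX; rewrite /GRing.comm mulrDr mulrDl mulr1 mul1r.
  by rewrite -!mulmxE -scalemxAl -scalemxAr.
(* The gap is closed by [tr (C^(K-1) (1 - M)) <= tr C^(K-1) <= tr C^K]. *)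
rewrite mulrBr mulr1 raddfB /= comMC.
apply: (@le_trans _ _ (\tr (C Om ^+ K.-1))); first by rewrite gerBl.
rewrite /upper_potential -/(C Om); case: (K) => //= K'.
by rewrite CS raddfD /= linearZ /= lerDl mulr_ge0.
Qed.

(** Iterates the one-step bound from the value [D] at the empty set. As long as at most half of the
    indices are drawn, [1 / (N - t) <= 2 / N], whence the factor 2. *)
Lemma upper_potential_avg m : (m.*2 <= #|T|)%N ->
  subset_avg m upper_potential <=
    D%:R * (1 + 2 * (eta * K%:R * (1 + eta * L) ^+ K) / #|T|%:R) ^+ m.
Proof.
set G := eta * K%:R * _; set N := #|T| => mN.
have G0 : 0 <= G by rewrite !mulr_ge0 // exprn_ge0 // addr_ge0 // mulr_ge0.
have q0 : 0 <= 2 * G / N%:R.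
  by apply: divr_ge0; [exact: mulr_ge0 | exact: ler0n].
suff H t : (t <= m)%N -> subset_avg t upper_potential <= D%:R * (1 + 2 * G / N%:R) ^+ t.
  exact: H.
elim: t => [|t IH] tm.
  by rewrite subset_avg0 expr0 mulr1 /upper_potential /M big_set0 scaler0 addr0 expr1n mxtrace1.
have tN' : (t < N)%N by rewrite (leq_trans tm) // (leq_trans _ mN) // -addnn leq_addr.
rewrite subset_avg_step //.
have Nt : (0 : R) < (N - t)%:R by rewrite ltr0n subn_gt0.
have Np : (0 : R) < N%:R by rewrite ltr0n (leq_ltn_trans _ tN').
apply: (@le_trans _ _ (subset_avg t (fun Om => (1 + 2 * G / N%:R) * upper_potential Om + 0))).
  apply: le_subset_avg => Om cO; rewrite addr0 ler_pdivrMr //.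
  apply: le_trans (upper_potential_step Om) _; rewrite cO -/N -/G mulrAC.
  rewrite ler_wpM2r ?upper_potential_ge0 // mulrDl mul1r lerD2l.
  have NN : N%:R <= 2 * (N - t)%:R :> R.
    rewrite -natrM ler_nat mul2n.
    rewrite -(leq_add2r t.*2) -doubleD subnK ?(ltnW tN') //.
    by rewrite -[X in (_ <= X)%N]addnn leq_add2l (leq_trans _ mN) // leq_double ltnW.
  by rewrite mulrAC ler_pdivlMr //; have := ler_wpM2l G0 NN; lra.
rewrite subset_avg_affine ?(ltnW tN') // addr0 exprS [leRHS]mulrCA.
by apply: ler_wpM2l; [exact: addr_ge0 | exact: IH (ltnW tm)].
Qed.

End Upper.

(** * The potential that controls the smallest eigenvalue *)

Section Lower.
Variables (eta : R) (K : nat).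
Hypotheses (eta_ge0 : 0 <= eta) (eta_lt1 : eta < 1).
Let C Om : 'M[R]_D := 1 - eta *: M Om.

Let CE Om : C Om = (1 - eta) *: (1 : 'M[R]_D) + eta *: ((1 : 'M[R]_D) - M Om).
Proof. by rewrite /C scalerBl scale1r scalerBr addrA subrK. Qed.

Lemma lower_op_psd Om : psdmx (1 - eta *: M Om).
Proof.
rewrite -/(C Om) CE; apply: psdmxD; apply: psdmxZ => //; first by rewrite subr_ge0 ltW.
  exact: psdmx1.
exact: frame_opC_psd.
Qed.

Let psdC Om : psdmx (C Om) := lower_op_psd Om.

Let comMC Om : GRing.comm (M Om) (C Om).
Proof.
rewrite /GRing.comm mulrBr mulrBl mulr1 mul1r.
by rewrite -!mulmxE -scalemxAl -scalemxAr.
Qed.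

Let comMC' Om : GRing.comm (1 - M Om) (C Om).
Proof. by apply/commr_sym/commrB; [exact: commr1|apply/commr_sym]. Qed.

Let psdMC Om j : psdmx (M Om * C Om ^+ j).
Proof.
have pM := frame_op_psd Om; have pM' := frame_opC_psd Om.
apply: psdmxMX => //; rewrite CE mulrDr -!mulmxE -!scalemxAr mulmx1.
apply: psdmxD; apply: psdmxZ => //; first by rewrite subr_ge0 ltW.
(* Since [M + (1 - M) = 1], the product is a sum of two congruences of positive matrices. *)
have -> : M Om *m (1 - M Om) =
    (1 - M Om) *m M Om *m (1 - M Om) + M Om *m (1 - M Om) *m M Om.
  have cM : (1 - M Om) * M Om = M Om * (1 - M Om).
    by rewrite mulrBl mulrBr mul1r mulr1.
  by rewrite !mulmxE -!mulrA cM -mulrDl subrK mul1r.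
have conj (P Q : 'M[R]_D) : psdmx P -> psdmx Q -> psdmx (P *m Q *m P).
  move=> [PT pP] [QT pQ]; split=> [|k X]; first by rewrite !trmx_mul PT QT mulmxA.
  have := pQ k (P *m X); rewrite /mxform trmx_mul PT !mulmxA //.
by apply: psdmxD; apply: conj.
Qed.

Let psdM'C Om j : psdmx ((1 - M Om) * C Om ^+ j).
Proof.
have pM' := frame_opC_psd Om.
apply: psdmxMX => //; rewrite CE mulrDr -!mulmxE -!scalemxAr mulmx1.
apply: psdmxD; apply: psdmxZ => //; first by rewrite subr_ge0 ltW.
exact: (psdmxX 2 pM').
Qed.

Definition lower_potential Om := \tr ((1 - eta *: M Om) ^+ K).

Lemma lower_potential_ge0 Om : 0 <= lower_potential Om.
Proof. by apply: psd_trace; apply: psdmxX; exact: psdC. Qed.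

Lemma lower_gap_ge0 Om : 0 <= \tr (C Om ^+ K * (1 - M Om)).
Proof.
have -> : C Om ^+ K * (1 - M Om) = (1 - M Om) * C Om ^+ K.
  by apply/esym/commrX.
by apply: psd_trace; exact: psdM'C.
Qed.

(* Spectrally: (1-x) y >= (1-b) (y - q) for y = (1-eta x)^K, q = (1-eta b)^K and
   0 <= x <= 1, because (b - x) (y - q) >= 0. *)
Lemma lower_gap (b : R) Om : 0 <= b <= 1 ->
  (1 - b) * (lower_potential Om - D%:R * (1 - eta * b) ^+ K) <=
    \tr (C Om ^+ K * (1 - M Om)).
Proof.
move=> /andP[b0 b1]; set q := 1 - eta * b.
have q0 : 0 <= q by rewrite subr_ge0 mulr_ile1 // ltW.
have M1 : \tr (M Om) <= D%:R.
  by have := psd_trace (frame_opC_psd Om); rewrite raddfB /= mxtrace1 subr_ge0.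
set B : 'M[R]_D := b *: (1 : 'M[R]_D) - M Om.
have BT : B^T = B.
  by rewrite /B raddfB /= linearZ /= trmx1; case: (frame_op_psd Om) => ->.
have cBC : GRing.comm B (C Om).
  apply/commr_sym/commrB; last by apply/commr_sym.
  by rewrite /GRing.comm -!mulmxE -scalemxAl -scalemxAr mulmx1 mul1mx.
have pBC j : psdmx (B * B * C Om ^+ j).
  have pB2 : psdmx (B * B).
    have := psdmx_gram B; by rewrite BT.
  apply: psdmxMX => //.
    rewrite -mulrA cBC mulrA -!mulmxE.
    have [CT pC] := psdC Om; split=> [|k X].
      by rewrite !trmx_mul CT BT mulmxA.
    by have := pC k (B *m X); rewrite /mxform trmx_mul BT !mulmxA.
  by rewrite /GRing.comm -mulrA cBC mulrA cBC mulrA.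
have BE : B = b *: (1 : 'M[R]_D) - M Om by [].
clearbody B.
(* Factoring [C^K - q^K] through [C - q = eta *: B] leaves [B * B] times powers of [C] with
   nonnegative coefficients. *)
have key : 0 <= \tr (B * C Om ^+ K) - q ^+ K * \tr B.
  have e : C Om - q *: (1 : 'M[R]_D) = eta *: B.
    by rewrite BE scalerBr /C /q scalerBl scale1r opprB scalerA addrC addrA subrK.
  have cq : GRing.comm (C Om) (q *: (1 : 'M[R]_D)).
    by rewrite /GRing.comm -!mulmxE -scalemxAl -scalemxAr mulmx1 mul1mx.
  have qX j : (q *: (1 : 'M[R]_D)) ^+ j = q ^+ j *: (1 : 'M[R]_D).
    elim: j => [|j IH]; first by rewrite !expr0 scale1r.
    by rewrite !exprS IH -mulmxE -scalemxAl mul1mx scalerA.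
  have := subrXX_comm K cq; rewrite qX e => f.
  have -> : \tr (B * C Om ^+ K) - q ^+ K * \tr B = \tr (B * (C Om ^+ K - q ^+ K *: (1 : 'M[R]_D))).
    by rewrite mulrBr raddfB /=; congr (_ - _); rewrite -mulmxE -scalemxAr mulmx1 linearZ.
  rewrite f mulr_sumr mulr_sumr raddf_sum /=; apply: sumr_ge0 => j _ /=.
  rewrite qX -!mulmxE -!scalemxAr mulmx1 -scalemxAl -scalemxAr !linearZ /=.
  by rewrite !mulr_ge0 ?exprn_ge0 // mulmxA psd_trace //; exact: pBC.
have -> : \tr (C Om ^+ K * (1 - M Om)) =
    (1 - b) * lower_potential Om + \tr (B * C Om ^+ K).
  have -> : B * C Om ^+ K = C Om ^+ K * B by apply: commrX.
  rewrite /lower_potential -/(C Om) BE !mulrBr !raddfB /= mulr1.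
  rewrite -mulmxE -scalemxAr mulmx1 linearZ /=; ring.
have : \tr B = b * D%:R - \tr (M Om) by rewrite BE raddfB /= linearZ /= mxtrace1.
have := exprn_ge0 K q0; nra.
Qed.

(** The rank-one update is read backwards: the old [C Om] is the new matrix [S] plus a rank-one
    term. The decrease is first bounded by a moment of [S], then returned to a moment of [C Om] at
    the price [(1 + h)^K], using the floor [1 - eta] of [S]. *)
Lemma lower_potential_step Om :
  \sum_(k | k \notin Om) lower_potential (k |: Om) <=
   (#|T| - #|Om|)%:R * lower_potential Om -
   eta * K%:R / (1 + eta * L / (1 - eta)) ^+ K * \tr (C Om ^+ K * (1 - M Om)).
Proof.
have b0 : 0 < 1 - eta by rewrite subr_gt0.
set h := eta * L / _.
have h0 : 0 <= h by rewrite divr_ge0 ?mulr_ge0 // ltW.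
set g := eta * K%:R / _.
have g0 : 0 <= g by rewrite divr_ge0 ?mulr_ge0 // exprn_ge0 // addr_ge0.
have step k : k \notin Om -> lower_potential (k |: Om) <=
    lower_potential Om - g * mxform (C Om ^+ K) (v k) (v k).
  move=> kO; set S := C (k |: Om).
  have eC : C Om = S + eta *: (v k *m (v k)^T).
    by rewrite /S /C frame_opU1 // scalerDr opprD addrA subrK.
  have pS : psdmx S := psdC _.
  have bS j : (1 - eta) * mxform (S ^+ j) (v k) (v k) <= mxform (S ^+ j.+1) (v k) (v k).
    have -> : S ^+ j.+1 = (1 - eta) *: S ^+ j + eta *: ((1 - M (k |: Om)) * S ^+ j).
      by rewrite exprS [X in X * _]CE mulrDl -!mulmxE -!scalemxAl mul1mx.
    rewrite mxformD !mxformZ.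
    by rewrite lerDl mulr_ge0 // mxform_ge0 //; exact: psdM'C.
  have := rank_one_trace_ge (v k) pS eta_ge0 K.
  rewrite -eC /lower_potential -/(C Om) -/S => h1.
  have := rank_one_moment_le pS eta_ge0 0 K.-1 b0 bS.
  rewrite -eC expr0 mulr1 add0n => h2.
  have p0 j : 0 <= mxform (S ^+ j) (v k) (v k) by apply: mxform_ge0; exact: psdmxX.
  (* As [C Om <= 1], the exponent may be raised to [K], the one for which [lower_gap] is stated. *)
  have h3 : mxform (C Om ^+ K) (v k) (v k) <= mxform (C Om ^+ K.-1) (v k) (v k).
    case: (K) => //= K'; rewrite exprS {1}/C mulrBl mul1r -mulmxE -scalemxAl.
    rewrite -scaleN1r mxformD mxformZ mulN1r gerBl mxformZ mulr_ge0 // mxform_ge0 //.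
    exact: psdMC.
  have h4 : mxform (C Om ^+ K) (v k) (v k) <= (1 + h) ^+ K * mxform (S ^+ K.-1) (v k) (v k).
    apply: le_trans h3 (le_trans h2 _); rewrite ler_wpM2r //.
    have tr0 := mxtrace_sqr_ge0 (v k).
    have t0 : 0 <= eta * \tr ((v k)^T *m v k) / (1 - eta).
      by rewrite divr_ge0 ?mulr_ge0 // ltW.
    apply: (@le_trans _ _ ((1 + eta * \tr ((v k)^T *m v k) / (1 - eta)) ^+ K)).
      by rewrite ler_weXn2l ?lerDl // leq_pred.
    rewrite lerXn2r ?nnegrE ?addr_ge0 // lerD2l /h ler_wpM2r ?invr_ge0 ?(ltW b0) //.
    by rewrite ler_wpM2l.
  apply: le_trans (_ : \tr (C Om ^+ K) - eta * K%:R * mxform (S ^+ K.-1) (v k) (v k) <= _).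
    by rewrite lerBrDr.
  rewrite lerD2l lerN2 /g -mulrA ler_wpM2l ?mulr_ge0 //.
  by rewrite mulrC ler_pdivrMr 1?mulrC // exprn_gt0 // ltr_pwDl.
apply: le_trans (ler_sum _ step) _.
rewrite big_split /= sumr_const sumrN -mulr_sumr sum_mxform_frame.
have -> : #|[pred k | k \notin Om]| = (#|T| - #|Om|)%N.
  by rewrite -(cardC (mem Om)) addKn; apply: eq_card.
by rewrite mulr_natl.
Qed.

(** By [lower_gap], the excess of the average over the level [y = D (1 - eta b)^K] shrinks by the
    factor [1 - rho] at each draw. Here [N - t <= N] suffices, so all sizes are covered. *)
Lemma lower_potential_avg (b : R) m : (m <= #|T|)%N -> 0 <= b <= 1 ->
  let rho := (1 - b) * (eta * K%:R / (1 + eta * L / (1 - eta)) ^+ K) / #|T|%:R in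
  rho <= 1 ->
  subset_avg m lower_potential <=
    D%:R * (1 - rho) ^+ m + D%:R * (1 - eta * b) ^+ K.
Proof.
set g := eta * _ / _; set N := #|T| => mN b01 rho rho1.
have b0 : 0 < 1 - eta by rewrite subr_gt0.
have g0 : 0 <= g.
  by rewrite divr_ge0 ?mulr_ge0 // exprn_ge0 // addr_ge0 // divr_ge0 ?mulr_ge0 // ltW.
set y := D%:R * (1 - eta * b) ^+ K.
have y0 : 0 <= y.
  case/andP: b01 => ? ?; rewrite mulr_ge0 // exprn_ge0 //; nra.
suff H t : (t <= m)%N -> subset_avg t lower_potential - y <= D%:R * (1 - rho) ^+ t.
  by rewrite -lerBlDr H.
elim: t => [|t IH] tm.
  rewrite subset_avg0 expr0 mulr1 /lower_potential /M big_set0 scaler0 subr0 expr1n.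
  by rewrite mxtrace1 gerBl.
have tN : (t < N)%N by rewrite (leq_trans tm).
rewrite subset_avg_step //.
have Nt : (0 : R) < (N - t)%:R by rewrite ltr0n subn_gt0.
have Np : (0 : R) < N%:R by rewrite ltr0n (leq_ltn_trans _ tN).
apply: (@le_trans _ _ (subset_avg t (fun Om => (1 - rho) * lower_potential Om + rho * y) - y)).
  rewrite lerD2r; apply: le_subset_avg => Om cO; rewrite ler_pdivrMr //.
  apply: le_trans (lower_potential_step Om) _; rewrite cO -/N -/g.
  have G0 := lower_gap_ge0 Om; have G1 := lower_gap Om b01; rewrite -/y in G1.
  set X := \tr _ in G0 G1 *; set F := lower_potential Om in G1 *.
  have r1 : rho * (F - y) <= g * X / N%:R.
    rewrite /rho mulrAC ler_pM2r ?invr_gt0 // mulrAC mulrC ler_wpM2l //.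
  have r2 : g * X / N%:R * (N - t)%:R <= g * X.
    rewrite mulrAC ler_pdivrMr //; apply: ler_wpM2l; first exact: mulr_ge0.
    by rewrite ler_nat leq_subr.
  apply: le_trans (_ : (F - g * X / N%:R) * (N - t)%:R <= _).
    rewrite mulrBl mulrC lerD2l lerN2 //.
  rewrite ler_pM2r //; lra.
rewrite subset_avg_affine ?(ltnW tN) // exprS [leRHS]mulrCA.
apply: le_trans (_ : (1 - rho) * (subset_avg t lower_potential - y) <= _); first lra.
by rewrite ler_wpM2l ?subr_ge0 // IH // ltnW.
Qed.
End Lower.
End Sampling.

(** * Concentration of the sampled frame operator *)

Section ExpEstimates.
Variable R : realType.

Lemma le_expR_inv (x : R) : x < 1 -> expR x <= (1 - x)^-1.
Proof.
move=> x1; rewrite -[x in expR x]opprK expRN lef_pV2 ?posrE ?expR_gt0 ?subr_gt0 //.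
exact: expR_ge1Dx.
Qed.

Lemma exprD1_le_expR (x : R) K : 0 <= 1 + x -> (1 + x) ^+ K <= expR (K%:R * x).
Proof. by move=> x0; rewrite expRM_natl lerXn2r ?nnegrE ?expR_ge0 ?expR_ge1Dx. Qed.

Lemma expR_half_le (x : R) K : 0 <= x <= 1 -> expR (K%:R * (x / 2)) <= (1 + x) ^+ K.
Proof.
move=> x01; rewrite expRM_natl lerXn2r ?nnegrE ?expR_ge0 //; first lra.
apply: le_trans (le_expR_inv _) _; first lra.
rewrite -ler_pV2 ?inE ?unitfE ?invr_gt0 ?invr_eq0; [|lra..].
rewrite invrK -[leLHS]mul1r ler_pdivrMr; [nra|lra].
Qed.

Lemma expR_double_le (x : R) K : 0 <= x <= 2^-1 ->
  expR (- (K%:R * (2 * x))) <= (1 - x) ^+ K.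
Proof.
move=> x01; rewrite -mulrN expRM_natl lerXn2r ?nnegrE ?expR_ge0 //; first lra.
apply: le_trans (le_expR_inv _) _; first lra.
rewrite -[leLHS]mul1r ler_pdivrMr; [nra|lra].
Qed.

(** The exponent is [1 / (1 - eta)] at the largest value [eta = 1 / 20] used below. *)
Lemma expR_20_19_le4 : expR (20 / 19 : R) <= 4.
Proof.
have -> : 20 / 19 = 4%:R * (5 / 19) :> R by lra.
rewrite expRM_natl; have h : expR (5 / 19 : R) <= 7 / 5.
  apply: le_trans (le_expR_inv _) _; first lra.
  have -> : (1 - 5 / 19)^-1 = 19 / 14 :> R by field.
  lra.
apply: le_trans (_ : (7 / 5) ^+ 4 <= _); last by rewrite !exprS expr0; lra.
by rewrite lerXn2r ?nnegrE ?expR_ge0 //; lra.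
Qed.
End ExpEstimates.

(** A single bad direction forces the potential to be large, which makes Markov's inequality
    applicable. After normalizing [z], this is Jensen followed by the trace bound. *)
Lemma psd_trace_exp_ge (R : rcfType) n (C : 'M[R]_n) (z : 'cV[R]_n) (c : R) K :
  psdmx C -> 0 <= c -> 0 < \tr (z^T *m z) -> c * \tr (z^T *m z) <= mxform C z z ->
  c ^+ K <= \tr (C ^+ K).
Proof.
move=> pC c0 z0 cz; set s := \tr (z^T *m z) in z0 cz *.
set a := (Num.sqrt s)^-1.
have a2 : a ^+ 2 * s = 1 by rewrite exprVn sqr_sqrtr ?ltW // mulVf // gt_eqF.
have scale (E : 'M[R]_n) : mxform E (a *: z) (a *: z) = a ^+ 2 * mxform E z z.
  by rewrite /mxform [(a *: z)^T]linearZ /= -!scalemxAl -scalemxAr !mxtraceZ mulrA.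
have u1 : \tr ((a *: z)^T *m (a *: z)) = 1.
  by rewrite -mxform1 scale mxform1.
have cu : c <= mxform C (a *: z) (a *: z).
  by rewrite scale -[c]mul1r -a2 mulrAC -mulrA ler_wpM2l ?sqr_ge0 // mulrC.
apply: le_trans (psd_form_le_trace (psdmxX K pC) u1).
apply: le_trans (psd_jensen K pC u1).
by rewrite lerXn2r ?nnegrE // (le_trans c0).
Qed.

Section FrameSampling.
Variables (R : realType) (T : finType) (D : nat) (v : T -> 'cV[R]_D).
Hypothesis tight : \sum_k v k *m (v k)^T = 1.
Variables (L : R) (m n : nat).
Hypotheses (L_gt0 : 0 < L) (short : forall k, \tr ((v k)^T *m v k) <= L).
Hypotheses (D_gt0 : (0 < D)%N) (n_gt1 : (1 < n)%N) (Dn : (D <= n ^ 2)%N).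
Hypotheses (mT : (m <= #|T|)%N) (mL : 32 * (L * #|T|%:R) * ln n%:R <= m%:R).

Local Notation N := #|T|.
Local Notation M := (frame_op v).

Let n0 : (0 : R) < n%:R.
Proof. by rewrite ltr0n ltnW. Qed.

Let N_gt0 : (0 : R) < N%:R.
Proof.
rewrite ltr0n lt0n; apply/negP => /eqP /card0_eq T0.
move: tight; rewrite big_pred0 // => /(congr1 mxtrace) /eqP.
by rewrite mxtrace0 mxtrace1 eq_sym pnatr_eq0 -leqn0 leqNgt D_gt0.
Qed.

(** Traces in the tight-frame identity: [D] is the sum of the squared lengths of the frame
    vectors. *)
Let LN : 1 <= L * N%:R.
Proof.
apply: (@le_trans _ _ D%:R); first by rewrite ler1n.
have <- : \tr (1 : 'M[R]_D) = D%:R := mxtrace1 R D.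
rewrite -tight raddf_sum mulr_natr -sumr_const /=.
by apply: ler_sum => k _; rewrite mxtrace_mulC.
Qed.

(** The sample size makes [tau >= 32 * ln n], that is [n <= E]; all tail estimates below are powers
    of [E]. *)
Let tau : R := m%:R / (L * N%:R).
Let E := expR (tau / 32).

Let tau0 : 0 <= tau.
Proof. by rewrite divr_ge0 // mulr_ge0 // ltW. Qed.

Let mN1 : m%:R / N%:R <= 1 :> R.
Proof. by rewrite ler_pdivrMr // mul1r ler_nat. Qed.

Let tauL : tau = m%:R / N%:R / L.
Proof. by rewrite /tau invfM mulrA mulrAC. Qed.

Let tau_le : tau <= L^-1.
Proof. by rewrite tauL ler_piMl ?invr_ge0 // ltW. Qed.

Let nE : n%:R <= E.
Proof.
rewrite /E -[leLHS]lnK ?posrE // ler_expR ler_pdivlMr // /tau ler_pdivlMr.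
  by move: mL; lra.
by rewrite (lt_le_trans ltr01).
Qed.

(** Chosen so that [eta <= 1 / 20] while [eta * K = 1 / L]: the power [(1 + eta x)^K] then behaves
    like [exp (x / L)]. *)
Let K : nat := (Num.bound (20 / L)).
Let eta : R := (K%:R * L)^-1.

Let K_ge : 20 / L <= K%:R.
Proof. by apply: ltW; apply: archi_boundP; rewrite divr_ge0 // ltW. Qed.

Let K_gt0 : (0 : R) < K%:R.
Proof. by apply: lt_le_trans K_ge; rewrite divr_gt0. Qed.

Let eta_ge0 : 0 <= eta.
Proof. by rewrite invr_ge0 mulr_ge0 // ltW. Qed.

Let eta_le : eta <= 20^-1.
Proof.
rewrite /eta lef_pV2 ?posrE ?mulr_gt0 //.
by move: K_ge; rewrite ler_pdivrMr.
Qed.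

Let etaK : eta * K%:R = L^-1.
Proof. by rewrite /eta invfM mulrAC mulVf ?gt_eqF // mul1r. Qed.

Let etaL : eta * L = K%:R^-1.
Proof. by rewrite /eta invfM -mulrA mulVf ?gt_eqF // mulr1. Qed.

Lemma frame_sampling_upper :
  #|[set Om : {set T} | (#|Om| == m) &&
     `[< exists z : 'cV_D, 20 * (m%:R / N%:R) * \tr (z^T *m z) < mxform (M Om) z z >]]|%:R
   / 'C(N, m)%:R <= (n%:R ^+ 2)^-1 :> R.
Proof.
(* If more than half of the indices are drawn, the threshold [20 m / N] exceeds 1 and [M Om <= 1]
   makes the event empty. *)
have [m2|m2] := leqP m.*2 N; last first.
  rewrite (_ : [set _ | _] = set0) ?cards0 ?mul0r ?invr_ge0 ?exprn_ge0 //.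
  apply/setP => Om; rewrite !inE; apply/negP => /andP[_ /asboolP[z]].
  apply/negP; rewrite -leNgt.
  have := mxform_ge0 z (frame_opC_psd tight Om).
  rewrite -scaleN1r mxformD mxformZ mulN1r subr_ge0 mxform1 => h; apply: le_trans h _.
  rewrite -[leLHS]mul1r ler_wpM2r ?mxtrace_sqr_ge0 //.
  rewrite mulrA ler_pdivlMr // mul1r.
  have : N%:R <= 2 * m%:R :> R by rewrite -natrM mul2n ler_nat ltnW.
  have := ler0n R m; lra.
set hi := 20 * (m%:R / N%:R).
have hi0 : 0 <= hi by rewrite mulr_ge0 // divr_ge0 // ltW.
have etahi : eta * hi <= 1.
  apply: le_trans (ler_pM eta_ge0 hi0 eta_le (_ : hi <= 20)) _; last lra.
  by rewrite /hi; move: mN1; lra.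
have c0 : 0 < (1 + eta * hi) ^+ K by rewrite exprn_gt0 // ltr_pwDl // mulr_ge0.
apply: le_trans (subset_markov m (f := upper_potential v eta K) c0 _ _) _.
- by move=> Om; apply: upper_potential_ge0.
- move=> Om /asboolP[z hz]; rewrite /upper_potential.
  have pU := upper_op_psd v eta_ge0 Om.
  have z0 : 0 < \tr (z^T *m z).
    rewrite lt_neqAle mxtrace_sqr_ge0 andbT eq_sym; apply/eqP => z0.
    have := psd_chebyshev z 1 1 (frame_op_psd v Om).
    rewrite z0 mul0r expr1 => h; move: hz; rewrite z0 mulr0; nra.
  apply: psd_trace_exp_ge z0 _ => //; first by rewrite addr_ge0 // mulr_ge0.
  rewrite mxformD mxformZ mxform1 mulrDl mul1r lerD2l -mulrA ler_wpM2l //.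
  exact: ltW.
have avg := upper_potential_avg tight (ltW L_gt0) short K eta_ge0 m2.
have E0 : 0 < E := expR_gt0 _.
(* The average is at most [D * exp (8 tau)] and the threshold potential at least [exp (10 tau)]; in
   units of [tau / 32] the exponents are 256 and 320. *)
apply: (@le_trans _ _ (D%:R * E ^+ 256 / E ^+ 320)).
  apply: ler_pM => //.
  - by apply: divr_ge0 => //; apply: sumr_ge0 => Om _; exact: upper_potential_ge0.
  - by rewrite invr_ge0 ltW.
  - apply: le_trans avg _; rewrite ler_wpM2l //.
    rewrite etaL etaK.
    have G4 : (1 + K%:R^-1) ^+ K <= 4 :> R.
      apply: le_trans (exprD1_le_expR _ _) _; first by rewrite addr_ge0 // invr_ge0 ltW.
      rewrite mulfV ?gt_eqF //; apply: le_trans (expR_20_19_le4 R).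
      by rewrite ler_expR; lra.
    apply: (@le_trans _ _ ((1 + 8 / (L * N%:R)) ^+ m)).
      rewrite lerXn2r ?nnegrE //.
      + rewrite addr_ge0 // !(mulr_ge0, invr_ge0, exprn_ge0, addr_ge0) //; exact: ltW.
      + by rewrite addr_ge0 // divr_ge0 // (le_trans ler01).
      rewrite lerD2l invfM [leRHS]mulrA ler_pM2r ?invr_gt0 //.
      have Li : 0 <= L^-1 by rewrite invr_ge0 ltW.
      by have := ler_wpM2l Li G4; lra.
    apply: le_trans (exprD1_le_expR _ _) _.
      by rewrite addr_ge0 // divr_ge0 // (le_trans ler01).
    rewrite /E -expRM_natl ler_expR /tau; lra.
  - rewrite lef_pV2 ?posrE // ?(exprn_gt0 320 E0) //.
    apply: le_trans (expR_half_le _ _); last by rewrite mulr_ge0.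
    rewrite /E -expRM_natl ler_expR.
    have -> : K%:R * (eta * hi / 2) = hi / L / 2.
      by rewrite -etaK; ring.
    by rewrite /hi tauL; lra.
have -> : D%:R * E ^+ 256 / E ^+ 320 = D%:R / E ^+ 64.
  by field; rewrite gt_eqF.
have E1 : 1 <= E by apply: le_trans nE; rewrite ler1n ltnW.
rewrite ler_pdivrMr ?exprn_gt0 // [leRHS]mulrC ler_pdivlMr ?exprn_gt0 //.
apply: (@le_trans _ _ (n%:R ^+ 2 * n%:R ^+ 2)).
  apply: ler_wpM2r; first by rewrite exprn_ge0 // ltW.
  by rewrite -natrX ler_nat.
rewrite -exprD; apply: (@le_trans _ _ (E ^+ 4)).
  by apply: lerXn2r; rewrite ?nnegrE // ltW.
by rewrite ler_weXn2l.
Qed.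

Lemma frame_sampling_lower :
  #|[set Om : {set T} | (#|Om| == m) &&
     `[< exists z : 'cV_D, mxform (M Om) z z < 64^-1 * (m%:R / N%:R) * \tr (z^T *m z) >]]|%:R
   / 'C(N, m)%:R <= (n%:R ^+ 2)^-1 :> R.
Proof.
set lo := 64^-1 * (m%:R / N%:R).
have lo0 : 0 <= lo by rewrite mulr_ge0 ?invr_ge0 // divr_ge0 // ltW.
have etalo : eta * lo <= 2^-1.
  apply: le_trans (ler_pM eta_ge0 lo0 eta_le (_ : lo <= 1)) _; last lra.
  by rewrite /lo; move: mN1; lra.
have c0 : 0 < (1 - eta * lo) ^+ K by rewrite exprn_gt0 //; lra.
have eta1 : eta < 1 by move: eta_le; lra.
apply: le_trans (subset_markov m (f := lower_potential v eta K) c0 _ _) _.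
- by move=> Om; apply: lower_potential_ge0.
- move=> Om /asboolP[z hz]; rewrite /lower_potential.
  have pU := lower_op_psd tight eta_ge0 eta1 Om.
  have z0 : 0 < \tr (z^T *m z).
    rewrite lt_neqAle mxtrace_sqr_ge0 andbT eq_sym; apply/eqP => z0.
    by have := mxform_ge0 z (frame_op_psd v Om); move: hz; rewrite z0 mulr0 ltNge => /negP.
  apply: psd_trace_exp_ge z0 _ => //; first lra.
  rewrite -scaleN1r scalerA mxformD mxformZ mxform1 mulrBl mul1r lerD2l mulN1r mulNr lerN2.
  by rewrite -mulrA ler_wpM2l // ltW.
have K1 : (0 < K)%N by rewrite -(ltr0n R).
set h := eta * L / (1 - eta).
have h0 : 0 <= h.
  by apply: divr_ge0; [rewrite mulr_ge0 // ltW|rewrite subr_ge0 ltW].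
have H4 : (1 + h) ^+ K <= 4.
  apply: le_trans (exprD1_le_expR _ _) _; first by rewrite addr_ge0.
  apply: le_trans (expR_20_19_le4 R); rewrite ler_expR /h etaL mulrA mulfV ?gt_eqF // mul1r.
  rewrite -[leLHS]mul1r ler_pdivrMr ?subr_gt0 //; move: eta_le; lra.
have H0 : 0 < (1 + h) ^+ K by rewrite exprn_gt0 // ltr_pwDl.
have gle : 4^-1 / L <= eta * K%:R / (1 + h) ^+ K.
  by rewrite etaK mulrC ler_pM2l ?invr_gt0 // lef_pV2 ?posrE.
have gge : eta * K%:R / (1 + h) ^+ K <= L^-1.
  rewrite etaK; apply: ler_piMr; first by rewrite invr_ge0 ltW.
  by rewrite invf_le1 // exprn_ege1 // lerDl.
(* With [b = 1 / 4] and [g >= 1 / (4 L)] the rate satisfies [rho >= 3 / (16 L N)], and the residual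
   level is at most [D * exp (- tau / 4)] because [tau <= 1 / L]. *)
have := @lower_potential_avg _ _ _ _ tight L (ltW L_gt0) short eta K eta_ge0 eta1 4^-1 m mT.
rewrite -/h; set g := eta * K%:R / _ in gle gge *.
move=> /(_ ltac:(lra)) /=.
set rho := (1 - 4^-1) * g / N%:R.
have rho_ge : 3 / 16 / (L * N%:R) <= rho.
  rewrite /rho invfM mulrA ler_pM2r ?invr_gt0 //; lra.
have rho_le : rho <= 1.
  rewrite /rho ler_pdivrMr // mul1r.
  apply: le_trans (_ : L^-1 <= _); last by rewrite -[leLHS]mul1r ler_pdivrMr // mulrC.
  have : 0 <= L^-1 by rewrite invr_ge0 ltW.
  by move: gge gle; lra.
move=> /(_ rho_le) avg.
have E0 : 0 < E := expR_gt0 _.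
(* Both terms of the average are at most [D * exp (- 3 tau / 16) = D / E^6], and the threshold
   potential is at least [exp (- tau / 32) = 1 / E]. The claim then follows from [2 * D <= n^3] and
   [n^5 <= E^5]. *)
apply: (@le_trans _ _ ((2 * D%:R / E ^+ 6) / E^-1)).
  apply: ler_pM => //.
  - by apply: divr_ge0 => //; apply: sumr_ge0 => Om _; exact: lower_potential_ge0.
  - by rewrite invr_ge0 ltW.
  - apply: le_trans avg _.
    have E6 : (E ^+ 6)^-1 = expR (- (3 / 16 * tau)).
      by rewrite /E -expRM_natl -expRN; congr expR; lra.
    have e1 : (1 - rho) ^+ m <= (E ^+ 6)^-1.
      apply: le_trans (exprD1_le_expR _ _) _; first by rewrite subr_ge0.
      rewrite E6 ler_expR mulrN lerN2 /tau.
      have := ler_wpM2l (ler0n R m) rho_ge; lra.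
    have e2 : (1 - eta * 4^-1) ^+ K <= (E ^+ 6)^-1.
      apply: le_trans (exprD1_le_expR _ _) _; first by move: eta_le; lra.
      rewrite E6 ler_expR mulrN lerN2.
      have -> : K%:R * (eta * 4^-1) = L^-1 / 4 by rewrite -etaK; ring.
      by move: tau_le tau0; lra.
    have D0 := ler0n R D.
    have := ler_wpM2l D0 e1; have := ler_wpM2l D0 e2; lra.
  - rewrite lef_pV2 ?posrE ?invr_gt0 //.
    apply: le_trans (expR_double_le _ _); last by rewrite mulr_ge0.
    rewrite /E -expRN ler_expR lerN2.
    have -> : K%:R * (2 * (eta * lo)) = 2 * lo / L by rewrite -etaK; ring.
    by rewrite /lo tauL; lra.
have -> : 2 * D%:R / E ^+ 6 / E^-1 = 2 * D%:R / E ^+ 5.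
  by field; rewrite gt_eqF.
rewrite ler_pdivrMr ?exprn_gt0 // [leRHS]mulrC ler_pdivlMr ?exprn_gt0 //.
apply: (@le_trans _ _ (n%:R * n%:R ^+ 2 * n%:R ^+ 2)).
  apply: ler_wpM2r; first by rewrite exprn_ge0 // ltW.
  by apply: ler_pM => //; rewrite -?natrX ler_nat.
rewrite -exprS -exprD; by apply: lerXn2r; rewrite ?nnegrE // ltW.
Qed.
End FrameSampling.

(** * Frobenius norm *)

Section Frobenius.
Variable R : realType.

Lemma frob_ge0 m n (X : 'M[R]_(m, n)) : 0 <= frob X.
Proof. exact: sqrtr_ge0. Qed.

Lemma frob2 m n (X : 'M[R]_(m, n)) : frob X ^+ 2 = \tr (X^T *m X).
Proof. by rewrite /frob -mxtrace_sqr sqr_sqrtr // mxtrace_sqr_ge0. Qed.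

Lemma frob_sqr_le m n k l (X : 'M[R]_(m, n)) (Y : 'M[R]_(k, l)) (c : R) : 0 <= c ->
  frob X ^+ 2 <= c ^+ 2 * frob Y ^+ 2 -> frob X <= c * frob Y.
Proof.
move=> c0; rewrite -exprMn ler_pXn2r // ?nnegrE ?frob_ge0 //.
by rewrite mulr_ge0 ?frob_ge0.
Qed.

Lemma le_frob m n k l (X : 'M[R]_(m, n)) (Y : 'M[R]_(k, l)) :
  \tr (X^T *m X) <= \tr (Y^T *m Y) -> frob X <= frob Y.
Proof. by move=> h; rewrite -[frob Y]mul1r frob_sqr_le // !frob2 expr1n mul1r. Qed.

Lemma eq_frob m n k l (X : 'M[R]_(m, n)) (Y : 'M[R]_(k, l)) :
  \tr (X^T *m X) = \tr (Y^T *m Y) -> frob X = frob Y.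
Proof. by move=> h; apply/le_anti/andP; split; apply: le_frob; rewrite h. Qed.

Lemma frob_tr m n (X : 'M[R]_(m, n)) : frob X^T = frob X.
Proof. by apply: eq_frob; rewrite trmxK mxtrace_mulC. Qed.

Lemma frobN m n (X : 'M[R]_(m, n)) : frob (- X) = frob X.
Proof. by apply: eq_frob; rewrite [(- X)^T]raddfN mulNmx mulmxN opprK. Qed.

Lemma frob_distC m n (X Y : 'M[R]_(m, n)) : frob (X - Y) = frob (Y - X).
Proof. by rewrite -frobN opprB. Qed.

Lemma frob_eq0 m n (X : 'M[R]_(m, n)) : frob X = 0 -> X = 0.
Proof.
move=> h; have := frob2 X; rewrite h expr0n /= => /esym/eqP.
rewrite mxtrace_sqr psumr_eq0 => [/allP H|i _]; last first.
  by apply: sumr_ge0 => j _; rewrite sqr_ge0.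
apply/matrixP => i j; have := H i (mem_index_enum _).
rewrite psumr_eq0 => [/allP /(_ j (mem_index_enum _))|? _]; last by rewrite sqr_ge0.
by rewrite sqrf_eq0 mxE => /eqP.
Qed.

Lemma frob_cauchy m n (X Y : 'M[R]_(m, n)) : `|\tr (X^T *m Y)| <= frob X * frob Y.
Proof.
rewrite -ler_sqr ?nnegrE ?mulr_ge0 ?frob_ge0 //.
have := psd_cauchy X Y (psdmx1 R m).
by rewrite !mxform1 real_normK ?num_real // exprMn !frob2.
Qed.

Lemma frob2D m n (X Y : 'M[R]_(m, n)) :
  frob (X + Y) ^+ 2 = frob X ^+ 2 + 2 * \tr (X^T *m Y) + frob Y ^+ 2.
Proof.
rewrite !frob2 [(X + Y)^T]raddfD /= mulmxDl !mulmxDr !mxtraceD.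
have -> : \tr (Y^T *m X) = \tr (X^T *m Y) by rewrite -mxtrace_tr trmx_mul trmxK.
ring.
Qed.

Lemma frobD_le m n (X Y : 'M[R]_(m, n)) : frob (X + Y) <= frob X + frob Y.
Proof.
rewrite -ler_sqr ?nnegrE ?addr_ge0 ?frob_ge0 // frob2D.
have := frob_cauchy X Y; have := ler_norm (\tr (X^T *m Y)).
by rewrite sqrrD -mulr_natr; lra.
Qed.

Lemma frobM_le m n k (X : 'M[R]_(m, n)) (Y : 'M[R]_(n, k)) :
  frob (X *m Y) <= frob X * frob Y.
Proof.
rewrite -ler_sqr ?nnegrE ?mulr_ge0 ?frob_ge0 // exprMn !frob2.
rewrite mxtrace_sqr -[\tr (X^T *m X)]mxtrace_mulC.
rewrite /mxtrace mulr_suml; apply: ler_sum => i _.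
rewrite mulr_sumr; apply: ler_sum => j _.
have := psd_cauchy ((row i X)^T) (col j Y) (psdmx1 R n).
rewrite !mxform1 trmxK.
have -> : \tr (row i X *m col j Y) = (X *m Y) i j.
  by rewrite /mxtrace big_ord1 !mxE; apply: eq_bigr => l _; rewrite !mxE.
have -> : \tr (row i X *m (row i X)^T) = (X *m X^T) i i.
  by rewrite /mxtrace big_ord1 !mxE; apply: eq_bigr => l _; rewrite !mxE.
suff -> : \tr ((col j Y)^T *m col j Y) = (Y^T *m Y) j j by [].
by rewrite /mxtrace big_ord1 !mxE; apply: eq_bigr => l _; rewrite !mxE.
Qed.

Definition contraction m n (P : 'M[R]_(m, n)) : Prop :=
  forall k (X : 'M[R]_(n, k)), frob (P *m X) <= frob X.

Lemma frob_isometry m n k (A : 'M[R]_(m, n)) (X : 'M[R]_(n, k)) :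
  is_isometry A -> frob (A *m X) = frob X.
Proof.
by move=> iA; apply: eq_frob; rewrite trmx_mul -mulmxA (mulmxA A^T) iA mul1mx.
Qed.

Lemma contraction_isometry m n (A : 'M[R]_(m, n)) : is_isometry A -> contraction A.
Proof. by move=> iA k X; rewrite frob_isometry. Qed.

Lemma contraction_proj n (P : 'M[R]_n) : P^T = P -> P *m P = P -> contraction P.
Proof.
move=> PT PP k X; apply: le_frob; rewrite -subr_ge0.
have e : (X - P *m X)^T *m (X - P *m X) = X^T *m X - (P *m X)^T *m (P *m X).
  rewrite [(_ - _)^T]raddfB /= !trmx_mul PT mulmxBr !mulmxBl -!mulmxA (mulmxA P P) PP.
  by rewrite subrr subr0.
by have := mxtrace_sqr_ge0 (X - P *m X); rewrite e raddfB.
Qed.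

Lemma contraction_isometry_tr m n (A : 'M[R]_(m, n)) :
  is_isometry A -> contraction A^T.
Proof.
move=> iA k X; rewrite -(frob_isometry _ iA) mulmxA.
apply: contraction_proj; first by rewrite trmx_mul trmxK.
by rewrite mulmxA -(mulmxA A) iA mulmx1.
Qed.

Lemma contractionM m n k (P : 'M[R]_(m, n)) (Q : 'M[R]_(n, k)) :
  contraction P -> contraction Q -> contraction (P *m Q).
Proof. by move=> cP cQ l X; rewrite -mulmxA (le_trans (cP _ _)). Qed.

Lemma contraction_trr m n k (P : 'M[R]_(n, k)) (X : 'M[R]_(m, n)) :
  contraction P^T -> frob (X *m P) <= frob X.
Proof. by move=> cP; rewrite -frob_tr trmx_mul (le_trans (cP _ _)) // frob_tr. Qed.

Lemma inj_unitmx n (N : 'M[R]_n) :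
  (forall y : 'cV_n, N *m y = 0 -> y = 0) -> N \in unitmx.
Proof.
move=> inj; rewrite -unitmx_tr -row_free_unit; apply: inj_row_free => y.
move=> /(congr1 trmx); rewrite trmx_mul trmxK trmx0 => /inj /(congr1 trmx).
by rewrite trmxK trmx0.
Qed.
End Frobenius.

(** * Lower bounds for the factors of an approximate factorization *)

Section GramLowerBound.
Variable R : realType.
Variables (d1 d2 r : nat).

(* Write x = V^T q y.  Then |U x| >= (s - e) |y| and |V x| >= |x|^2 / |y|; whichever
   of the two is larger for the given |y| is enough, since |U x| is close to |V x|. *)
Lemma gram_lower_bound (Z : 'M[R]_(d1, d2)) (U : 'M[R]_(d1, r)) (V : 'M[R]_(d2, r))
    (p : 'M[R]_(d1, r)) (q : 'M[R]_(d2, r)) (s : R) (x : 'cV[R]_r) :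
  contraction p^T -> contraction q ->
  (forall y : 'cV[R]_r, s * frob y <= frob (p^T *m Z *m q *m y)) ->
  frob (U *m V^T - Z) < s ->
  (s - frob (U *m V^T - Z) - frob (U^T *m U - V^T *m V)) * frob x ^+ 2 <= frob (U *m x) ^+ 2.
Proof.
move=> cp cq hs; set E := frob (U *m V^T - Z); set dl := frob (_ - _) => Es.
(* The compression of [U V^T] by the frames inherits the floor of [Z] up to the error [E]; this
   makes the square matrix [V^T q] invertible. *)
have Ny (y : 'cV_r) : (s - E) * frob y <= frob (p^T *m U *m (V^T *m q) *m y).
  have h1 := hs y.
  have e : p^T *m Z *m q *m y =
      p^T *m U *m (V^T *m q) *m y + p^T *m ((Z - U *m V^T) *m (q *m y)).
    by rewrite mulmxBl mulmxBr !mulmxA addrC subrK.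
  have h2 := frobD_le (p^T *m U *m (V^T *m q) *m y) (p^T *m ((Z - U *m V^T) *m (q *m y))).
  rewrite -e in h2.
  have h3 := cp _ ((Z - U *m V^T) *m (q *m y)).
  have h4 := frobM_le (Z - U *m V^T) (q *m y); rewrite frob_distC -/E in h4.
  have h5 := ler_wpM2l (frob_ge0 _ : 0 <= E) (cq _ y).
  lra.
have uN : V^T *m q \in unitmx.
  apply: inj_unitmx => y y0; apply: frob_eq0; apply/eqP.
  have := Ny y; rewrite -mulmxA y0 mulmx0.
  have -> : frob (0 : 'cV[R]_r) = 0.
    by apply/eqP; rewrite -sqrf_eq0 frob2 mulmx0 mxtrace0.
  by rewrite pmulr_rle0 ?subr_gt0 // eq_le frob_ge0 andbT.
set y := invmx (V^T *m q) *m x.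
have xy : V^T *m q *m y = x by rewrite /y mulKVmx.
have k1 : (s - E) * frob y <= frob (U *m x).
  apply: le_trans (Ny y) _; rewrite -(mulmxA (p^T *m U)) xy -mulmxA; exact: cp.
have k2 : frob x ^+ 2 <= frob (V *m x) * frob y.
  rewrite frob2 -{2}xy.
  have -> : x^T *m (V^T *m q *m y) = (V *m x)^T *m (q *m y) by rewrite trmx_mul !mulmxA.
  apply: le_trans (ler_norm _) _; apply: le_trans (frob_cauchy _ _) _.
  by rewrite ler_wpM2l ?frob_ge0.
have k3 : frob (V *m x) ^+ 2 - dl * frob x ^+ 2 <= frob (U *m x) ^+ 2.
  have e : frob (U *m x) ^+ 2 - frob (V *m x) ^+ 2 =
      \tr (x^T *m ((U^T *m U - V^T *m V) *m x)).
    by rewrite !frob2 !trmx_mul mulmxBl mulmxBr raddfB /= !mulmxA.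
  have := frob_cauchy x ((U^T *m U - V^T *m V) *m x); rewrite -e.
  have := ler_wpM2l (frob_ge0 x) (frobM_le (U^T *m U - V^T *m V) x).
  rewrite -/dl ler_norml => h /andP[h' _]; nra.
move: k1 k2 k3; have := frob_ge0 x; have := frob_ge0 y; have := frob_ge0 (U *m x).
have := frob_ge0 (V *m x); have dl0 : 0 <= dl := frob_ge0 _.
move: (frob x) (frob y) (frob (U *m x)) (frob (V *m x)) => a b u w w0 u0 b0 a0 k1 k2 k3.
set t := s - E in k1 *; have t0 : 0 < t by rewrite subr_gt0.
have [h|h] := leP (t * b ^+ 2) (a ^+ 2).
  have [->|an0] := eqVneq a 0; first by rewrite expr0n mulr0 sqr_ge0.
  have ap : 0 < a ^+ 2 by rewrite exprn_even_gt0.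
  have bp : 0 < b.
    rewrite lt_neqAle eq_sym b0 andbT; apply/eqP => bz.
    by move: k2; rewrite bz mulr0 leNgt ap.
  have : t * a ^+ 2 <= w ^+ 2; last by lra.
  have b2 : 0 < b ^+ 2 by rewrite exprn_gt0.
  rewrite -(ler_pM2r b2) -[w ^+ 2 * _]exprMn.
  apply: (@le_trans _ _ (a ^+ 2 * a ^+ 2)); first by rewrite mulrAC ler_pM2r.
  by rewrite -expr2 lerXn2r ?nnegrE ?sqr_ge0 ?mulr_ge0.
have : t ^+ 2 * b ^+ 2 <= u ^+ 2.
  by rewrite -exprMn lerXn2r ?nnegrE // mulr_ge0 // ltW.
have : 0 <= dl * a ^+ 2 by rewrite mulr_ge0 // sqr_ge0.
have := ler_wpM2l (ltW t0) (ltW h); lra.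
Qed.
End GramLowerBound.

(** * Singular values *)

Section SpectralFloor.
Variable R : realType.

Definition rdiag m n (d : nat -> R) : 'M[R]_(m, n) :=
  \matrix_(i < m, j < n) (if (i == j :> nat) then d i else 0).

Lemma eq_rdiag m n (d e : nat -> R) :
  (forall i, (i < m)%N -> (i < n)%N -> d i = e i) -> rdiag m n d = rdiag m n e.
Proof.
by move=> de; apply/matrixP => i j; rewrite !mxE; case: eqP => // ij; rewrite de // ij.
Qed.

Lemma rdiag_tr m n d : (rdiag m n d)^T = rdiag n m d.
Proof. by apply/matrixP => i j; rewrite !mxE eq_sym; case: eqP => // ->. Qed.

Lemma rdiagM m n k d e : rdiag m n d *m rdiag n k e =
  rdiag m k (fun i => if (i < n)%N then d i * e i else 0).
Proof.
apply/matrixP => i j; rewrite !mxE.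
have [ln|nl] := ltnP i n.
  rewrite (bigD1 (Ordinal ln)) //= !mxE /= eqxx big1 ?addr0.
    by case: eqP => // _; rewrite mulr0.
  move=> l /eqP li; rewrite !mxE; case: eqP => [il|]; last by rewrite mul0r.
  by case: li; apply: val_inj.
rewrite big1 => [|l _]; first by case: ifP.
by rewrite mxE gtn_eqF ?mul0r // (leq_trans (ltn_ord l)).
Qed.

Lemma rdiag_pid m n k : rdiag m n (fun i => (i < k)%:R) = pid_mx k.
Proof. by apply/matrixP => i j; rewrite !mxE; case: eqP. Qed.

Lemma rdiag1 n d : (forall i, (i < n)%N -> d i = 1) -> rdiag n n d = 1%:M.
Proof.
move=> d1; apply/matrixP => i j; rewrite !mxE; case: eqP => [/val_inj ->|ij].
  by rewrite eqxx d1.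
by case: eqP => // e; case: ij; rewrite e.
Qed.

Lemma mul_rdiag_sq n k d (Y : 'M[R]_(n, k)) i j : (rdiag n n d *m Y) i j = d i * Y i j.
Proof.
rewrite mxE (bigD1 i) //= mxE eqxx big1 ?addr0 // => l li.
by rewrite mxE; case: eqP => [/val_inj il|]; [rewrite il eqxx in li|rewrite mul0r].
Qed.

Lemma frob_rdiag_ge n k (d : nat -> R) (s : R) (Y : 'M[R]_(n, k)) : 0 <= s ->
  (forall i, (i < n)%N -> s <= d i) -> s * frob Y <= frob (rdiag n n d *m Y).
Proof.
move=> s0 sd; rewrite -ler_sqr ?nnegrE ?mulr_ge0 ?frob_ge0 // exprMn !frob2 !mxtrace_sqr.
rewrite mulr_sumr; apply: ler_sum => i _; rewrite mulr_sumr; apply: ler_sum => j _.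
rewrite mul_rdiag_sq exprMn ler_wpM2r ?sqr_ge0 // lerXn2r ?nnegrE // ?sd //.
by rewrite (le_trans s0) // sd.
Qed.

Lemma frob_rdiag_le m n k (d : nat -> R) (c : R) (X : 'M[R]_(k, m)) : 0 <= c ->
  (forall i, (i < m)%N -> (i < n)%N -> `|d i| <= c) -> frob (X *m rdiag m n d) <= c * frob X.
Proof.
move=> c0 dc; rewrite -[frob X]frob_tr -frob_tr frob_sqr_le // !frob2 trmxK trmx_mul trmxK.
rewrite rdiag_tr -mulmxA (mulmxA (rdiag m n d)) rdiagM mxtrace_mulC.
set D := rdiag m m _.
have -> : X *m X^T = (X^T)^T *m X^T by rewrite trmxK.
rewrite [in leRHS]mxtrace_sqr /mxtrace.
rewrite mulr_sumr; apply: ler_sum => i _; rewrite mulr_sumr mxE; apply: ler_sum => j _.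
rewrite mul_rdiag_sq !mxE -mulrA -expr2 ler_wpM2r ?sqr_ge0 //.
case: ifP => ilt; last by rewrite sqr_ge0.
by rewrite -[leLHS]real_normK ?num_real // lerXn2r ?nnegrE ?dc.
Qed.

(* The consequences of [is_singular_value Z r s] that survive compression by A and
   B: a generalized inverse of norm at most 1/s, and r-dimensional frames on which
   Z is bounded below by s. *)
Definition spectral_floor d1 d2 r (Z : 'M[R]_(d1, d2)) (s : R) : Prop :=
  [/\ 0 < s,
      exists2 W : 'M[R]_(d2, d1), Z *m W *m Z = Z &
        forall k l (X : 'M[R]_(k, d2)) (Y : 'M[R]_(d1, l)),
          frob (X *m W *m Y) <= frob X * frob Y / s &
      exists (p : 'M[R]_(d1, r)) (q : 'M[R]_(d2, r)),
        [/\ contraction p /\ contraction p^T, contraction q /\ contraction q^T,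
            forall y : 'cV[R]_r, s * frob y <= frob (p^T *m Z *m q *m y) &
            forall y : 'cV[R]_r, s * frob y <= frob (q^T *m Z^T *m p *m y)]].

(** Both claims are rank counts: a zero at index [r.-1] would leave at most [r.-1] nonzero entries,
    and a nonzero entry at [i >= r] would let [pid_mx i.+1] factor through the matrix. *)
Lemma singular_value_pos n1 n2 r (d : nat -> R) : (0 < r)%N -> (r <= n1)%N -> (r <= n2)%N ->
  (forall i : nat, (i < minn n1 n2)%N -> 0 <= d i) ->
  (forall i j : nat, (i <= j)%N -> (j < minn n1 n2)%N -> d j <= d i) ->
  \rank (rdiag n1 n2 d) = r ->
  0 < d r.-1 /\ forall i, (r <= i)%N -> (i < minn n1 n2)%N -> d i = 0.
Proof.
move=> r0 r1 r2 d0 dm rk.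
have rm : (r.-1 < minn n1 n2)%N by rewrite prednK // leq_min r1 r2.
split.
  rewrite lt_neqAle d0 // andbT eq_sym; apply/eqP => z.
  have e : rdiag n1 n2 d = rdiag n1 n1 (fun i => (i < r.-1)%:R) *m rdiag n1 n2 d.
    rewrite rdiagM; apply: eq_rdiag => i i1 i2; rewrite i1.
    have [?|ri] := ltnP i r.-1; first by rewrite mul1r.
    rewrite mul0r; apply/le_anti/andP; split; last by rewrite d0 // leq_min i1.
    by rewrite -z dm // leq_min i1.
  have := mxrankM_maxl (rdiag n1 n1 (fun i => (i < r.-1)%:R)) (rdiag n1 n2 d).
  rewrite -e rk rdiag_pid rank_pid_mx ?(leq_trans (leq_pred _)) //.
  by rewrite -ltnS prednK // ltnn.
move=> i ri im; apply/eqP/negPn/negP => di.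
have pos j : (j <= i)%N -> 0 < d j.
  move=> ji; apply: lt_le_trans (dm _ _ ji im).
  by rewrite lt_neqAle eq_sym di d0.
move: im; rewrite leq_min => /andP[i1 i2].
have e : rdiag n1 n2 d *m rdiag n2 n1 (fun j => if (j < i.+1)%N then (d j)^-1 else 0) = pid_mx i.+1.
  rewrite rdiagM -rdiag_pid; apply: eq_rdiag => j j1 _.
  case: (ltnP j i.+1) => ji; last by case: ifP => //; rewrite mulr0.
  by rewrite (leq_ltn_trans _ i2) // mulfV // gt_eqF // pos.
have := mxrankM_maxl (rdiag n1 n2 d) (rdiag n2 n1 (fun j => if (j < i.+1)%N then (d j)^-1 else 0)).
by rewrite e rk rank_pid_mx // ltnNge ri.
Qed.

Lemma singular_value_floor n1 n2 d1 d2 r (A : 'M[R]_(n1, d1)) (B : 'M[R]_(n2, d2))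
    (Z : 'M[R]_(d1, d2)) (s : R) :
  (0 < r)%N -> (r <= n1)%N -> (r <= n2)%N -> is_isometry A -> is_isometry B ->
  \rank (A *m Z *m B^T) = r -> is_singular_value (A *m Z *m B^T) r s ->
  spectral_floor r Z s.
Proof.
move=> r0 r1 r2 iA iB rk [P [Q [d [PP [QQ [d0 [dm [svd ->]]]]]]]].
rewrite -/(rdiag n1 n2 d) in svd.
have eS : rdiag n1 n2 d = P^T *m (A *m Z *m B^T) *m Q.
  by rewrite svd !mulmxA PP mul1mx -mulmxA QQ mulmx1.
have rS : \rank (rdiag n1 n2 d) = r.
  apply/eqP; rewrite eqn_leq; apply/andP; split.
    by rewrite eS -rk (leq_trans (mxrankM_maxl _ _)) // mxrankM_maxr.
  by rewrite -rk svd (leq_trans (mxrankM_maxl _ _)) // mxrankM_maxr.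
have [s0 dz] := singular_value_pos r0 r1 r2 d0 dm rS.
have eZ : Z = A^T *m (P *m rdiag n1 n2 d *m Q^T) *m B.
  by rewrite -svd !mulmxA iA mul1mx -mulmxA iB mulmx1.
have AAP : A *m A^T *m (P *m rdiag n1 n2 d *m Q^T) = P *m rdiag n1 n2 d *m Q^T.
  by rewrite -svd !mulmxA -(mulmxA A A^T A) iA mulmx1.
have BBP : P *m rdiag n1 n2 d *m Q^T *m (B *m B^T) = P *m rdiag n1 n2 d *m Q^T.
  by rewrite -svd !mulmxA -(mulmxA _ B^T B) iB mulmx1.
have cA := contraction_isometry iA; have cAT := contraction_isometry_tr iA.
have cB := contraction_isometry iB; have cBT := contraction_isometry_tr iB.
have cP := contraction_isometry PP; have cPT := contraction_isometry_tr PP.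
have cQ := contraction_isometry QQ; have cQT := contraction_isometry_tr QQ.
split=> //.
  (* The pseudoinverse from the singular value decomposition, pulled back to the coordinates of [A]
     and [B]; the convention that 0 has inverse 0 takes care of the vanishing singular values. *)
  exists (B^T *m Q *m rdiag n2 n1 (fun i => (d i)^-1) *m P^T *m A).
    set Sp := rdiag n2 n1 _.
    have SSS : rdiag n1 n2 d *m Sp *m rdiag n1 n2 d = rdiag n1 n2 d.
      rewrite !rdiagM; apply: eq_rdiag => i i1 i2; rewrite i1 i2.
      by have [->|nz] := eqVneq (d i) 0; rewrite ?mulr0 // mulfV // mul1r.
    have -> : Z *m (B^T *m Q *m Sp *m P^T *m A) *m Z =
      A^T *m (P *m rdiag n1 n2 d *m Q^T *m (B *m B^T)) *m Q *m Sp *m P^T *m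
       (A *m A^T *m (P *m rdiag n1 n2 d *m Q^T)) *m B by rewrite {1 2}eZ !mulmxA.
    rewrite AAP BBP [RHS]eZ -[in RHS]SSS !mulmxA.
    by rewrite -(mulmxA _ Q^T Q) QQ mulmx1 -(mulmxA _ P^T P) PP mulmx1.
  move=> k l X Y; rewrite -!mulmxA.
  rewrite (mulmxA X) (mulmxA _ Q) (mulmxA _ (rdiag _ _ _)) (mulmxA P^T).
  apply: le_trans (frobM_le _ _) _; rewrite [leRHS]mulrAC.
  apply: ler_pM; rewrite ?frob_ge0 //.
    apply: le_trans (@frob_rdiag_le _ _ _ _ (d r.-1)^-1 _ _ _) _; first by rewrite invr_ge0 ltW.
      move=> i i2 i1; have im : (i < minn n1 n2)%N by rewrite leq_min i1.
      rewrite normfV ger0_norm ?d0 //.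
      have [ri|ir] := leqP r i; first by rewrite dz // invr0 invr_ge0 ltW.
      have dri : d r.-1 <= d i by rewrite dm // ?leq_min ?prednK ?r1 // -ltnS prednK.
      by rewrite lef_pV2 ?posrE // (lt_le_trans s0).
    rewrite mulrC ler_wpM2r ?invr_ge0 ?(ltW s0) //.
    apply: le_trans (contraction_trr _ cQT) _.
    by apply: contraction_trr; rewrite trmxK.
  by apply: le_trans (contractionM cPT cA _) _.
have J n : (r <= n)%N -> is_isometry (rdiag n r (fun=> 1)).
  by move=> rn; rewrite /is_isometry rdiag_tr rdiagM rdiag1 // => i ir; rewrite (leq_trans ir) ?mulr1.
(* The leading [r] left and right singular vectors in the coordinates of [A] and [B]. *)
pose p := A^T *m (P *m rdiag n1 r (fun=> 1)); pose q := B^T *m (Q *m rdiag n2 r (fun=> 1)).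
have pZq : p^T *m Z *m q = rdiag r r d.
  have -> : p^T *m Z *m q = rdiag r n1 (fun=> 1) *m P^T *m
      (A *m A^T *m (P *m rdiag n1 n2 d *m Q^T) *m (B *m B^T)) *m Q *m rdiag n2 r (fun=> 1).
    by rewrite /p /q {1}eZ !trmx_mul trmxK rdiag_tr !mulmxA.
  rewrite AAP BBP !mulmxA -(mulmxA _ P^T P) PP mulmx1 -(mulmxA _ Q^T Q) QQ mulmx1.
  rewrite !rdiagM; apply: eq_rdiag => i ir _.
  by rewrite !(leq_trans ir) // mul1r mulr1.
have dge i : (i < r)%N -> d r.-1 <= d i.
  by move=> ir; rewrite dm // ?leq_min ?prednK ?r1 // -ltnS prednK.
exists p, q; split.
- split; first by do ![apply: contractionM => //]; apply: contraction_isometry; exact: J.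
  rewrite !trmx_mul trmxK; do ![apply: contractionM => //].
  by apply: contraction_isometry_tr; exact: J.
- split; first by do ![apply: contractionM => //]; apply: contraction_isometry; exact: J.
  rewrite !trmx_mul trmxK; do ![apply: contractionM => //].
  by apply: contraction_isometry_tr; exact: J.
- by move=> y; rewrite pZq frob_rdiag_ge // ltW.
- move=> y; have -> : q^T *m Z^T *m p = rdiag r r d.
    by rewrite -[RHS]rdiag_tr -pZq (trmx_mul _ q) (trmx_mul p^T Z) trmxK mulmxA.
  by rewrite frob_rdiag_ge // ltW.
Qed.
End SpectralFloor.

(** * One Gauss-Newton step *)

Section OneStep.
Variable R : realType.

Lemma gram_lower_bound_sq d k r (U : 'M[R]_(d, r)) (a : R) (Y : 'M[R]_(r, k)) :
  (forall x : 'cV[R]_r, a * frob x ^+ 2 <= frob (U *m x) ^+ 2) ->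
  a * frob Y ^+ 2 <= frob (U *m Y) ^+ 2.
Proof.
have cols m (X : 'M[R]_(m, k)) : frob X ^+ 2 = \sum_j frob (col j X) ^+ 2.
  rewrite frob2 mxtrace_sqr exchange_big; apply: eq_bigr => j _ /=.
  rewrite frob2 mxtrace_sqr; apply: eq_bigr => i _.
  by rewrite big_ord1 mxE.
move=> H; rewrite !cols mulr_sumr; apply: ler_sum => j _.
by have := H (col j Y); rewrite !colE mulmxA.
Qed.

Section Projector.
Variables (d r : nat) (U : 'M[R]_(d, r)) (a : R).
Hypothesis a_gt0 : 0 < a.
Hypothesis floorU : forall x : 'cV[R]_r, a * frob x ^+ 2 <= frob (U *m x) ^+ 2.

(** The orthogonal projection onto the complement of the column space of [U], once the Gram matrix
    is invertible. *)
Definition coproj : 'M[R]_d := 1%:M - U *m invmx (U^T *m U) *m U^T.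

Lemma gram_unit : U^T *m U \in unitmx.
Proof.
apply: inj_unitmx => y y0; apply: frob_eq0; apply/eqP; rewrite -sqrf_eq0.
have := floorU y; rewrite [frob (U *m y) ^+ 2]frob2 trmx_mul -!mulmxA (mulmxA U^T) y0.
by rewrite mulmx0 mxtrace0 pmulr_rle0 // eq_le sqr_ge0 andbT.
Qed.

Lemma coproj_tr : coproj^T = coproj.
Proof.
rewrite /coproj raddfB /= trmx1 !trmx_mul trmxK trmx_inv trmx_mul trmxK.
by rewrite mulmxA.
Qed.

Lemma coprojU : coproj *m U = 0.
Proof.
by rewrite mulmxBl mul1mx -!mulmxA mulVmx ?gram_unit // mulmx1 subrr.
Qed.

Lemma coproj_idem : coproj *m coproj = coproj.
Proof.
by rewrite {2}/coproj mulmxBr mulmx1 !mulmxA coprojU !mul0mx subr0.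
Qed.

Lemma contraction_coproj : contraction coproj.
Proof. exact: contraction_proj coproj_tr coproj_idem. Qed.
End Projector.

(** The projection annihilates [U V^T], so it sees only the error. *)
Lemma coproj_mul_le d e r (U : 'M[R]_(d, r)) (V : 'M[R]_(e, r)) (Z : 'M[R]_(d, e)) (a : R) :
  0 < a -> (forall x : 'cV[R]_r, a * frob x ^+ 2 <= frob (U *m x) ^+ 2) ->
  frob (coproj U *m Z) <= frob (U *m V^T - Z).
Proof.
move=> a0 fU; rewrite frob_distC.
have -> : coproj U *m Z = coproj U *m (Z - U *m V^T).
  by rewrite mulmxBr mulmxA (coprojU a0 fU) mul0mx subr0.
exact: contraction_coproj a0 fU _ _.
Qed.

(** First-order optimality, as the discriminant inequality with zero constant term. *)
Lemma linear_min_eq0 (k q : R) : (forall t : R, 2 * t * k <= t ^+ 2 * q) -> k = 0.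
Proof.
move=> H; apply/eqP; rewrite -sqrf_eq0 eq_le sqr_ge0 andbT.
have := @sqr_le_of_quadratic_ge0 R 0 k q.
by rewrite mul0r; apply => t; have := H (- t); rewrite add0r sqrrN; lra.
Qed.

Section Step.
Variables (d1 d2 r : nat) (meas : 'M[R]_(d1, d2) -> R) (lo : R).
Hypothesis lo_gt0 : 0 < lo.
Hypothesis rip : forall X, lo * frob X ^+ 2 <= meas X <= 1280 * lo * frob X ^+ 2.
Variables (Z : 'M[R]_(d1, d2)) (s : R).
Hypothesis floorZ : spectral_floor r Z s.
Variables (U dU : 'M[R]_(d1, r)) (V dV : 'M[R]_(d2, r)).

Let lin (dU : 'M[R]_(d1, r)) (dV : 'M[R]_(d2, r)) := U *m V^T + U *m dV^T + dU *m V^T - Z.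

Hypothesis min_meas : forall dU' dV', meas (lin dU dV) <= meas (lin dU' dV').
Hypothesis min_norm : forall dU' dV', meas (lin dU' dV') <= meas (lin dU dV) ->
  frob dU ^+ 2 + frob dV ^+ 2 <= frob dU' ^+ 2 + frob dV' ^+ 2.

Let e := frob (U *m V^T - Z).
Let dl := frob (U^T *m U - V^T *m V).
Hypotheses (small : e + dl <= s / 2) (small' : 36 * e <= s).

Let s_gt0 : 0 < s. Proof. by case: floorZ. Qed.
Let e_ge0 : 0 <= e. Proof. exact: frob_ge0. Qed.
Let dl_ge0 : 0 <= dl. Proof. exact: frob_ge0. Qed.
Let e_lt : e < s. Proof. by move: small dl_ge0 s_gt0; lra. Qed.

Let floorU (x : 'cV[R]_r) : s / 2 * frob x ^+ 2 <= frob (U *m x) ^+ 2.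
Proof.
have [_ _ [p [q [[_ cp] [cq _] h _]]]] := floorZ.
have := gram_lower_bound x cp cq h e_lt; rewrite -/e -/dl.
by apply: le_trans; rewrite ler_wpM2r ?sqr_ge0 //; move: small; lra.
Qed.

Let floorV (x : 'cV[R]_r) : s / 2 * frob x ^+ 2 <= frob (V *m x) ^+ 2.
Proof.
have [_ _ [p [q [[cp _] [_ cq] _ h]]]] := floorZ.
have eT : frob (V *m U^T - Z^T) = e.
  by rewrite -frob_tr raddfB /= trmx_mul !trmxK.
have := @gram_lower_bound _ _ _ _ Z^T V U q p s x cq cp h.
rewrite eT (frob_distC (V^T *m V)) -/dl => /(_ e_lt).
by apply: le_trans; rewrite ler_wpM2r ?sqr_ge0 //; move: small; lra.
Qed.

Let s2 : 0 < s / 2. Proof. by rewrite divr_gt0. Qed.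

(* The comparison point (G^-1 U^T Z, (1 - P_U) Z V H^-1) makes the linearization
   equal to Z up to the component of Z normal to both factors. *)
Lemma comparison_residual : exists dU' dV',
  frob (lin dU' dV') <= e ^+ 2 / s.
Proof.
exists (coproj U *m Z *m V *m invmx (V^T *m V)), (Z^T *m U *m invmx (U^T *m U) - V).
have GT n (X : 'M[R]_(n, r)) : (invmx (X^T *m X))^T = invmx (X^T *m X).
  by rewrite trmx_inv trmx_mul trmxK.
have -> : lin (coproj U *m Z *m V *m invmx (V^T *m V)) (Z^T *m U *m invmx (U^T *m U) - V) =
    - (coproj U *m Z *m coproj V).
  have e1 : U *m (Z^T *m U *m invmx (U^T *m U) - V)^T = Z - coproj U *m Z - U *m V^T.
    rewrite raddfB /= !trmx_mul GT trmxK mulmxBr /coproj mulmxBl mul1mx subKr.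
    by rewrite !mulmxA.
  have e2 : coproj U *m Z *m V *m invmx (V^T *m V) *m V^T =
      coproj U *m Z - coproj U *m Z *m coproj V.
    by rewrite {3}/coproj mulmxBr mulmx1 subKr !mulmxA.
  rewrite /lin e1 e2; move: (coproj U *m Z *m coproj V) (coproj U *m Z) (U *m V^T) => W X Y.
  by apply/matrixP => i j; rewrite !mxE; ring.
have [_ [W ZWZ Wle] _] := floorZ.
(* Writing [Z = Z W Z] puts one normal component of [Z] on each side of [W]: each is at most [e],
   and [W] contributes [1 / s]. *)
rewrite frobN -[in X in frob X]ZWZ.
have -> : coproj U *m (Z *m W *m Z) *m coproj V =
    (coproj U *m Z) *m W *m (Z *m coproj V) by rewrite !mulmxA.
apply: le_trans (Wle _ _ _ _) _; rewrite ler_pM2r ?invr_gt0 // expr2.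
apply: ler_pM; rewrite ?frob_ge0 //; first exact: coproj_mul_le s2 floorU.
rewrite -frob_tr trmx_mul coproj_tr.
apply: le_trans (coproj_mul_le U Z^T s2 floorV) _.
by rewrite -frob_tr raddfB /= trmx_mul !trmxK.
Qed.

(** The minimizer measures no worse than the comparison point; passing between measurements and
    norms costs the square root of 1280, which is below 36. *)
Lemma minimizer_residual : frob (lin dU dV) <= 36 * (e ^+ 2 / s).
Proof.
have [dU' [dV' h]] := comparison_residual.
apply: le_trans (ler_wpM2l _ h) => //.
apply: frob_sqr_le => //.
have /andP[l1 _] := rip (lin dU dV); have /andP[_ l2] := rip (lin dU' dV').
rewrite -(ler_pM2l lo_gt0); apply: le_trans l1 (le_trans (min_meas _ _) (le_trans l2 _)).
have := mulr_ge0 (ltW lo_gt0) (sqr_ge0 (frob (lin dU' dV'))); lra.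
Qed.

(* The linearization is constant along (U K, - V K^T), so that the minimal-norm
   step is orthogonal to this direction; take K = U^T dU - dV^T V. *)
Lemma minimizer_balanced : U^T *m dU = dV^T *m V.
Proof.
apply/eqP; rewrite -subr_eq0; apply/eqP; apply: frob_eq0; apply/eqP.
rewrite -sqrf_eq0; apply/eqP.
have [K KE] : exists K, K = U^T *m dU - dV^T *m V by exists (U^T *m dU - dV^T *m V).
rewrite -KE.
apply: (@linear_min_eq0 _ (frob (U *m K) ^+ 2 + frob (V *m K^T) ^+ 2)) => t.
have e1 : lin (dU + (- t) *: (U *m K)) (dV + t *: (V *m K^T)) = lin dU dV.
  rewrite /lin raddfD /= linearZ /= trmx_mul trmxK mulmxDr mulmxDl.
  rewrite -scalemxAr -scalemxAl scaleNr (mulmxA U K).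
  move: (U *m K *m V^T) (U *m V^T) (U *m dV^T) (dU *m V^T) => X Y P Q.
  by apply/matrixP => i j; rewrite !mxE; ring.
have := @min_norm (dU + (- t) *: (U *m K)) (dV + t *: (V *m K^T)).
rewrite e1 lexx => /(_ isT); rewrite !frob2D.
have sc m n (a : R) (X : 'M[R]_(m, n)) : frob (a *: X) ^+ 2 = a ^+ 2 * frob X ^+ 2.
  by rewrite !frob2 [(a *: X)^T]linearZ /= -scalemxAl -scalemxAr !mxtraceZ mulrA.
rewrite !sc -!scalemxAr !linearZ /= sqrrN.
have -> : frob K ^+ 2 = \tr (dU^T *m (U *m K)) - \tr (dV^T *m (V *m K^T)).
  rewrite frob2 {1}KE raddfB /= !trmx_mul !trmxK mulmxBl raddfB /= -!mulmxA; congr (_ - _).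
  by rewrite -[LHS]mxtrace_tr !trmx_mul trmxK -mulmxA mxtrace_mulC mulmxA.
lra.
Qed.

(** By balance the inner product of the two parts of [L] is [|U^T dU|^2], so the floors give
    [|L|^2 >= s / 2 * (|dU|^2 + |dV|^2)]. On the other side [|L| <= 2 * e], the residual being at
    most [e]. *)
Lemma minimizer_step_norm : frob dU ^+ 2 + frob dV ^+ 2 <= 8 * (e ^+ 2 / s).
Proof.
set L := U *m dV^T + dU *m V^T.
have cross : 0 <= \tr ((U *m dV^T)^T *m (dU *m V^T)).
  have -> : \tr ((U *m dV^T)^T *m (dU *m V^T)) = \tr ((dV^T *m V)^T *m (U^T *m dU)).
    by rewrite !trmx_mul !trmxK !mulmxA mxtrace_mulC !mulmxA.
  by rewrite minimizer_balanced mxtrace_sqr_ge0.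
have hV : s / 2 * frob dV ^+ 2 <= frob (U *m dV^T) ^+ 2.
  by rewrite -[frob dV]frob_tr; exact: gram_lower_bound_sq floorU.
have hU : s / 2 * frob dU ^+ 2 <= frob (dU *m V^T) ^+ 2.
  rewrite -[frob dU]frob_tr -[frob (_ *m _)]frob_tr trmx_mul trmxK.
  exact: gram_lower_bound_sq floorV.
have hL : frob L ^+ 2 = frob (U *m dV^T) ^+ 2 + 2 * \tr ((U *m dV^T)^T *m (dU *m V^T))
   + frob (dU *m V^T) ^+ 2 by rewrite frob2D.
have L2 : frob L <= 2 * e.
  have -> : L = lin dU dV + - (U *m V^T - Z).
    rewrite /lin /L; move: (U *m V^T) (U *m dV^T) (dU *m V^T) => *.
    by apply/matrixP => i j; rewrite !mxE; ring.
  apply: le_trans (frobD_le _ _) _; rewrite frobN -/e.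
  apply: le_trans (lerD minimizer_residual (lexx _)) _.
  suff : 36 * (e ^+ 2 / s) <= e by lra.
  rewrite mulrA ler_pdivrMr // expr2 mulrA [e * s]mulrC ler_wpM2r //.
have L4 : frob L ^+ 2 <= (2 * e) ^+ 2 by rewrite lerXn2r ?nnegrE ?frob_ge0 // mulr_ge0.
rewrite mulrA ler_pdivlMr //; lra.
Qed.

(** The new error is the linear residual plus [dU dV^T], hence [40 = 36 + 8 / 2]. In the imbalance
    the first-order terms cancel by [minimizer_balanced], leaving only terms quadratic in the
    step. *)
Lemma gnimc_step_contracts :
  frob ((U + dU) *m (V + dV)^T - Z) <= 40 * (e ^+ 2 / s) /\
  frob ((U + dU)^T *m (U + dU) - (V + dV)^T *m (V + dV)) <= dl + 8 * (e ^+ 2 / s).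
Proof.
have N := minimizer_step_norm; split.
  have -> : (U + dU) *m (V + dV)^T - Z = lin dU dV + dU *m dV^T.
    rewrite raddfD /= mulmxDl !mulmxDr /lin -!addrA; do 2![congr (_ + _)].
    by rewrite [RHS]addrA [dU *m dV^T - Z]addrC addrA.
  apply: le_trans (frobD_le _ _) _.
  have := minimizer_residual; have := frobM_le dU dV^T; rewrite frob_tr.
  have := sqr_ge0 (frob dU - frob dV); nra.
have -> : (U + dU)^T *m (U + dU) - (V + dV)^T *m (V + dV) =
    (U^T *m U - V^T *m V) + (dU^T *m dU - dV^T *m dV).
  have b1 := minimizer_balanced.
  have b2 : dU^T *m U = V^T *m dV.
    by rewrite -[LHS]trmxK trmx_mul trmxK b1 trmx_mul trmxK.
  rewrite ![(_ + _)^T]raddfD /= !mulmxDl !mulmxDr b1 b2.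
  move: (U^T *m U) (V^T *m V) (dV^T *m V) (V^T *m dV) (dU^T *m dU) (dV^T *m dV) => *.
  by apply/matrixP => i j; rewrite !mxE; ring.
apply: le_trans (frobD_le _ _) _; rewrite lerD2l; apply: le_trans N.
apply: le_trans (frobD_le _ _) _; rewrite frobN.
apply: lerD; rewrite expr2; apply: le_trans (frobM_le _ _) _; by rewrite frob_tr.
Qed.
End Step.
End OneStep.

(** * Iteration and entry sampling *)

Section Convergence.
Variable R : realType.

Lemma POmegaB n1 n2 (Om : {set 'I_n1 * 'I_n2}) (X Y : 'M[R]_(n1, n2)) :
  POmega Om X - POmega Om Y = POmega Om (X - Y).
Proof. by apply/matrixP => i j; rewrite !mxE; case: ifP; rewrite ?subr0. Qed.

Lemma frob_lift n1 n2 d1 d2 (A : 'M[R]_(n1, d1)) (B : 'M[R]_(n2, d2)) (X : 'M[R]_(d1, d2)) :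
  is_isometry A -> is_isometry B -> frob (A *m X *m B^T) = frob X.
Proof.
by move=> iA iB; rewrite -frob_tr trmx_mul trmxK frob_isometry // frob_tr frob_isometry.
Qed.

Lemma gnimc_quadratic n1 n2 d1 d2 r (A : 'M[R]_(n1, d1)) (B : 'M[R]_(n2, d2))
    (Xs : 'M[R]_(n1, n2)) (s lo : R) (Om : {set 'I_n1 * 'I_n2})
    (U : nat -> 'M[R]_(d1, r)) (V : nat -> 'M[R]_(d2, r)) :
  (0 < r)%N -> (r <= n1)%N -> (r <= n2)%N -> is_isometry A -> is_isometry B ->
  \rank Xs = r -> (Xs^T <= A^T)%MS -> (Xs <= B^T)%MS -> is_singular_value Xs r s ->
  0 < lo ->
  (forall X : 'M[R]_(d1, d2), lo * frob X ^+ 2 <=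
     frob (POmega Om (A *m X *m B^T)) ^+ 2 <= 1280 * lo * frob X ^+ 2) ->
  frob (A *m U 0%N *m (V 0%N)^T *m B^T - Xs) <= s / 200 ->
  frob ((U 0%N)^T *m U 0%N - (V 0%N)^T *m V 0%N) <= s / (2 * 200) ->
  gnimc_iterates A B Om (POmega Om Xs) U V ->
  forall t, frob (A *m U t.+1 *m (V t.+1)^T *m B^T - Xs)
    <= (200 / (2 * s)) * frob (A *m U t *m (V t)^T *m B^T - Xs) ^+ 2.
Proof.
move=> r0 r1 r2 iA iB rk subA subB sv lo0 rip.
(* The span conditions say that [A A^T] and [B B^T] fix [Xs], so [Z = A^T Xs B] works. *)
have [Z XZ] : exists Z, Xs = A *m Z *m B^T.
  case/submxP: subA => D1 /(congr1 trmx); rewrite trmxK trmx_mul trmxK => e1.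
  case/submxP: subB => D2 e2; exists (A^T *m Xs *m B).
  have eA : A *m A^T *m Xs = Xs by rewrite e1 mulmxA -(mulmxA A) iA mulmx1.
  have eB : Xs *m (B *m B^T) = Xs by rewrite e2 -mulmxA (mulmxA B^T) iB mul1mx.
  by rewrite !mulmxA eA -mulmxA eB.
rewrite {}XZ in rk sv *.
have fl := singular_value_floor r0 r1 r2 iA iB rk sv.
have [s0 _ _] := fl.
have frobA t : frob (A *m U t *m (V t)^T *m B^T - A *m Z *m B^T) = frob (U t *m (V t)^T - Z).
  by rewrite -(mulmxA A) -mulmxBl -mulmxBr frob_lift.
rewrite frobA => e0 dl0 it.
pose e t := frob (U t *m (V t)^T - Z).
pose dl t := frob ((U t)^T *m U t - (V t)^T *m V t).
have step t : e t + dl t <= s / 2 -> 36 * e t <= s ->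
    e t.+1 <= 40 * (e t ^+ 2 / s) /\ dl t.+1 <= dl t + 8 * (e t ^+ 2 / s).
  move=> h1 h2; have [m1 m2] := it t.
  pose meas X := frob (POmega Om (A *m X *m B^T)) ^+ 2.
  have obj dU dV : gn_obj A B Om (POmega Om (A *m Z *m B^T)) (U t) (V t) dU dV =
      meas (U t *m (V t)^T + U t *m dV^T + dU *m (V t)^T - Z).
    by rewrite /gn_obj POmegaB -mulmxBl -mulmxBr.
  have := @gnimc_step_contracts R d1 d2 r meas lo lo0 rip Z s fl (U t) (U t.+1 - U t)
    (V t) (V t.+1 - V t).
  rewrite !(addrC (_ t) (_ - _)) !subrK; apply => //.
  - by move=> dU dV; have := m1 dU dV; rewrite !obj.
  - by move=> dU dV; have := m2 dU dV; rewrite !obj.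
(* The term [16 * e^2 / s] is a reserve for all future growth of the imbalance: a step adds at most
   [8 * e^2 / s] to [dl], while halving [e] divides the reserve by at least 4. *)
have inv t : e t <= s / 200 /\ dl t + 16 * (e t ^+ 2 / s) <= s / 4.
  elim: t => [|t [IH1 IH2]].
    split=> //; have e00 : 0 <= e 0%N := frob_ge0 _.
    have : e 0%N ^+ 2 <= s / 200 * (s / 200).
      by rewrite expr2 ler_pM.
    have -> : s / 200 * (s / 200) = s / 200 / 200 * s by ring.
    rewrite -ler_pdivrMr // => h.
    have h' : dl 0%N <= s / (2 * 200) := dl0.
    have h3 : dl 0%N <= s / 400.
      by apply: le_trans h' _; have -> : s / (2 * 200) = s / 400 by field.
    by lra.
  have et0 : 0 <= e t := frob_ge0 _; have es0 : 0 <= e t.+1 := frob_ge0 _.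
  have dt0 : 0 <= dl t := frob_ge0 _.
  have q0 : 0 <= e t ^+ 2 / s by rewrite divr_ge0 ?sqr_ge0 // ltW.
  have [] := step t; [lra..|] => k1 k2.
  have q1 : e t ^+ 2 / s <= e t / 200.
    by rewrite ler_pdivrMr // expr2 -mulrA ler_wpM2l // mulrC.
  have k3 : e t.+1 <= e t / 2 by lra.
  have k4 : e t.+1 ^+ 2 / s <= e t ^+ 2 / s / 4.
    rewrite [leRHS]mulrAC ler_pM2r ?invr_gt0 //.
    by have := ler_pM es0 es0 k3 k3; rewrite !expr2; lra.
  by split; lra.
move=> t; rewrite !frobA -/(e t) -/(e t.+1).
have [i1 i2] := inv t.
have q0 : 0 <= e t ^+ 2 / s by rewrite divr_ge0 ?sqr_ge0 // ltW.
have dt0 : 0 <= dl t := frob_ge0 _.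
have [] := step t; [lra..|] => k1 _.
apply: le_trans k1 _.
(* The factor to reach is 100, and the step provides 40. *)
have -> : 200 / (2 * s) * e t ^+ 2 = 100 * (e t ^+ 2 / s).
  by field; rewrite gt_eqF.
by lra.
Qed.
End Convergence.

(** * The tight frame attached to the matrix entries *)

Section EntrySampling.
Variable R : realType.

Lemma mxvec_dot m n (X Y : 'M[R]_(m, n)) :
  \tr (mxvec X *m (mxvec Y)^T) = \tr (X^T *m Y).
Proof.
rewrite mxtrace_mulC /mxtrace.
have -> : \sum_(i < m * n) ((mxvec Y)^T *m mxvec X) i i =
    \sum_(i < m * n) mxvec Y 0 i * mxvec X 0 i.
  by apply: eq_bigr => i _; rewrite mxE big_ord1 mxE.
rewrite (reindex _ (@curry_mxvec_bij m n)) /=.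
transitivity (\sum_(i < m) \sum_(j < n)
    mxvec Y 0 (mxvec_index i j) * mxvec X 0 (mxvec_index i j)).
  by rewrite pair_bigA; apply: eq_bigr => -[i j] _.
rewrite exchange_big; apply: eq_bigr => j _; rewrite mxE; apply: eq_bigr => i _.
by rewrite !mxvecE mxE mulrC.
Qed.

Variables (n1 n2 d1 d2 : nat) (A : 'M[R]_(n1, d1)) (B : 'M[R]_(n2, d2)).
Hypotheses (iA : is_isometry A) (iB : is_isometry B).

(** The tensor product of a row of [A] and a row of [B]; pairing it with the vectorization of [X]
    reads off one entry of [A X B^T]. *)
Definition entry_vec (k : 'I_n1 * 'I_n2) : 'cV[R]_(d1 * d2) :=
  (mxvec ((row k.1 A)^T *m row k.2 B))^T.

Lemma entry_vec_dot k (X : 'M[R]_(d1, d2)) :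
  (entry_vec k)^T *m (mxvec X)^T = ((A *m X *m B^T) k.1 k.2)%:M.
Proof.
rewrite /entry_vec trmxK mxvec_dotmul [LHS]mx11_scalar; congr (_%:M).
by rewrite -row_mul tr_row !mxE; apply: eq_bigr => l _; rewrite !mxE.
Qed.

(** Entrywise, the sum over pairs factors into an entry of [A^T A] times an entry of [B^T B]. *)
Lemma entry_vec_tight : \sum_k entry_vec k *m (entry_vec k)^T = 1.
Proof.
apply/matrixP => x y; case/mxvec_indexP: x => a b; case/mxvec_indexP: y => a' b'.
rewrite summxE.
have E k : (entry_vec k *m (entry_vec k)^T) (mxvec_index a b) (mxvec_index a' b') =
   (A k.1 a * A k.1 a') * (B k.2 b * B k.2 b').
  by rewrite /entry_vec mxE big_ord1 !mxE !mxvecE !mxE !big_ord1 !mxE; ring.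
under eq_bigr do rewrite E.
rewrite -(pair_bigA _ (fun i j => (A i a * A i a') * (B j b * B j b'))) /=.
under eq_bigr do rewrite -mulr_sumr.
rewrite -mulr_suml.
have -> : \sum_i A i a * A i a' = (a == a')%:R.
  have := congr1 (fun M : 'M_d1 => M a a') iA; rewrite !mxE => <-.
  by apply: eq_bigr => i _; rewrite mxE.
have -> : \sum_i B i b * B i b' = (b == b')%:R.
  have := congr1 (fun M : 'M_d2 => M b b') iB; rewrite !mxE => <-.
  by apply: eq_bigr => i _; rewrite mxE.
rewrite -natrM mulnb [RHS]mxE; congr (_%:R); congr nat_of_bool.
apply/idP/eqP => [/andP[/eqP -> /eqP ->] //|e].
have [g gK _] := @curry_mxvec_bij d1 d2.
have : (a, b) = (a', b') by rewrite -(gK (a, b)) // -(gK (a', b')) //= e.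
case=> -> ->.
by rewrite !eqxx.
Qed.

Lemma entry_vec_form (Om : {set 'I_n1 * 'I_n2}) (X : 'M[R]_(d1, d2)) :
  mxform (frame_op entry_vec Om) (mxvec X)^T (mxvec X)^T =
    frob (POmega Om (A *m X *m B^T)) ^+ 2.
Proof.
rewrite frob2 mxtrace_sqr pair_bigA /= /mxform /frame_op mulmx_sumr mulmx_suml raddf_sum /=.
rewrite big_mkcond; apply: eq_bigr => k _ /=.
rewrite mxE -surjective_pairing; case: ifP => _; last by rewrite expr0n.
rewrite trmxK !mulmxA -(mulmxA (_ *m _)).
have -> : mxvec X *m entry_vec k = ((entry_vec k)^T *m (mxvec X)^T)^T.
  by rewrite trmx_mul !trmxK.
by rewrite !entry_vec_dot tr_scalar_mx -scalar_mxM mxtrace_scalar mulr1n expr2.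
Qed.

Lemma rownorm2 n d (C : 'M[R]_(n, d)) i : rownorm C i ^+ 2 = (C *m C^T) i i.
Proof.
rewrite /rownorm sqr_sqrtr; last by apply: sumr_ge0 => j _; rewrite sqr_ge0.
by rewrite mxE; apply: eq_bigr => j _; rewrite mxE.
Qed.

Lemma entry_vec_norm k :
  \tr ((entry_vec k)^T *m entry_vec k) = rownorm A k.1 ^+ 2 * rownorm B k.2 ^+ 2.
Proof.
rewrite {2}/entry_vec entry_vec_dot !rownorm2 mxtrace_scalar mulr1n.
rewrite -[A *m (_ *m _) *m _]mulmxA -[_ *m row _ B *m _]mulmxA mulmxA mxE big_ord1.
by congr (_ * _); rewrite !mxE; apply: eq_bigr => j _; rewrite !mxE.
Qed.

(** For [mu <= 0] the square root takes the value 0, all rows vanish, and the trace of [C C^T] could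
    not be [d]. *)
Lemma coherence_gt0 (mu : R) n d (C : 'M[R]_(n, d)) : (0 < d)%N -> (d <= n)%N ->
  is_isometry C -> norm2inf_le C (Num.sqrt (mu * d%:R / n%:R)) -> 0 < mu.
Proof.
move=> d0 dn iC hC; rewrite ltNge; apply/negP => mu0.
have : mu * d%:R / n%:R <= 0 by rewrite -mulrA mulr_le0_ge0 // divr_ge0.
move=> /ler0_sqrtr z.
have : \tr (C *m C^T) = 0.
  rewrite /mxtrace big1 // => i _; rewrite -rownorm2; apply/eqP; rewrite sqrf_eq0.
  by rewrite eq_le sqrtr_ge0 andbT -z; exact: hC.
rewrite mxtrace_mulC iC mxtrace1 => /eqP; rewrite pnatr_eq0 => /eqP dz.
by rewrite dz in d0.
Qed.
End EntrySampling.

(** Union bound over the two failure events [P] and [Q]; [m <= n1 * n2] keeps the number of subsets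
    positive. *)
Lemma prob_unif_subsets_ge (R : realType) n1 n2 m (E : {set 'I_n1 * 'I_n2} -> Prop)
    (P Q : pred {set 'I_n1 * 'I_n2}) (a : R) :
  (m <= n1 * n2)%N ->
  (forall Om : {set 'I_n1 * 'I_n2}, #|Om| = m -> ~~ P Om -> ~~ Q Om -> E Om) ->
  #|[set Om : {set 'I_n1 * 'I_n2} | (#|Om| == m) && P Om]|%:R /
    'C(#|{: 'I_n1 * 'I_n2}|, m)%:R <= a ->
  #|[set Om : {set 'I_n1 * 'I_n2} | (#|Om| == m) && Q Om]|%:R /
    'C(#|{: 'I_n1 * 'I_n2}|, m)%:R <= a ->
  1 - 2 * a <= prob_unif_subsets m E.
Proof.
move=> mN H hP hQ; rewrite /prob_unif_subsets card_draws.
set b : R := 'C(_, m)%:R in hP hQ *.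
have b0 : 0 < b by rewrite ltr0n bin_gt0 card_prod !card_ord.
move: hP hQ; rewrite !ler_pdivrMr // ler_pdivlMr //.
set Ps := [set Om | _ && P Om]; set Qs := [set Om | _ && Q Om]; set Es := [set Om | _].
have : ('C(#|{: 'I_n1 * 'I_n2}|, m) <= #|Es| + (#|Ps| + #|Qs|))%N.
  rewrite -card_draws; apply: (@leq_trans #|Es :|: (Ps :|: Qs)|); last first.
    apply: leq_trans (leq_card_setU _ _) _; rewrite leq_add2l.
    exact: leq_card_setU.
  apply: subset_leq_card; apply/subsetP => Om; rewrite !inE => cO; rewrite cO /=.
  case: (boolP (P Om)) => nP; rewrite ?orbT //.
  case: (boolP (Q Om)) => nQ; rewrite ?orbT // !orbF.
  by apply/asboolP; apply: H => //; exact/eqP.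
rewrite -(ler_nat R) !natrD -/b; lra.
Qed.

Unset Implicit Arguments.

Theorem theorem5p1 (R : realType) :
  exists c : R, 1 < c /\
  forall (n1 n2 d1 d2 r : nat),
    (0 < r)%N -> (r <= d1)%N -> (d1 <= n1)%N -> (r <= d2)%N -> (d2 <= n2)%N ->
  forall (mu : R) (A : 'M[R]_(n1, d1)) (B : 'M[R]_(n2, d2)) (Xs : 'M[R]_(n1, n2))
         (sr : R) (m : nat),
    is_isometry A -> is_isometry B ->
    norm2inf_le A (Num.sqrt (mu * d1%:R / n1%:R)) ->
    norm2inf_le B (Num.sqrt (mu * d2%:R / n2%:R)) ->
    \rank Xs = r ->
    (Xs^T <= A^T)%MS -> (Xs <= B^T)%MS ->
    is_singular_value Xs r sr ->
    (m <= n1 * n2)%N ->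
    32 * mu ^+ 2 * d1%:R * d2%:R * ln ((maxn n1 n2)%:R) <= m%:R ->
    prob_unif_subsets (R:=R) m (fun Om : {set 'I_n1 * 'I_n2} =>
      forall (U : nat -> 'M[R]_(d1, r)) (V : nat -> 'M[R]_(d2, r)),
        frob (A *m U 0%N *m (V 0%N)^T *m B^T - Xs) <= sr / c ->
        frob ((U 0%N)^T *m U 0%N - (V 0%N)^T *m V 0%N) <= sr / (2 * c) ->
        gnimc_iterates A B Om (POmega Om Xs) U V ->
        forall t : nat,
          frob (A *m U t.+1 *m (V t.+1)^T *m B^T - Xs)
            <= (c / (2 * sr)) * frob (A *m U t *m (V t)^T *m B^T - Xs) ^+ 2)
    >= 1 - 2 / ((maxn n1 n2)%:R ^+ 2).
Proof.
(* An initial error of at most [s / 200] gives [40 * e^2 / s <= e / 5], and [40 <= 200 / 2] yields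
   the stated rate. *)
exists 200; split; first lra.
move=> n1 n2 d1 d2 r r0 rd1 dn1 rd2 dn2 mu A B Xs sr m iA iB hA hB rk sA sB sv mN hm.
have d10 : (0 < d1)%N by apply: leq_trans rd1.
have d20 : (0 < d2)%N by apply: leq_trans rd2.
have n10 : (0 < n1)%N by apply: leq_trans dn1.
have n20 : (0 < n2)%N by apply: leq_trans dn2.
set n := maxn n1 n2 in hm *.
have n0 : (0 < n)%N by rewrite leq_max n10.
(* For [n = 1] the claimed probability is negative; otherwise [ln n > 0], which forces [m > 0]. *)
have [n1'|n1'] := leqP n 1.
  have -> : n = 1%N by apply/eqP; rewrite eqn_leq n1'.
  apply: (@le_trans _ _ 0); first by rewrite expr1n; lra.
  by rewrite /prob_unif_subsets divr_ge0.
set N := #|{: 'I_n1 * 'I_n2}|.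
have NE : N%:R = n1%:R * n2%:R :> R by rewrite /N card_prod !card_ord natrM.
have mu0 : 0 < mu by apply: coherence_gt0 d10 dn1 iA hA.
(* The product of the two coherence bounds, hence a bound on the squared length of every
   [entry_vec]; the sampling hypothesis becomes [32 * L * N * ln n <= m]. *)
pose L : R := mu ^+ 2 * d1%:R * d2%:R / N%:R.
have [d1p d2p n1p n2p] : [/\ 0 < d1%:R :> R, 0 < d2%:R :> R, 0 < n1%:R :> R & 0 < n2%:R :> R].
  by rewrite !ltr0n.
have Np : 0 < N%:R :> R by rewrite NE mulr_gt0.
have L0 : 0 < L by rewrite divr_gt0 // !mulr_gt0 // exprn_gt0.
have LN : L * N%:R = mu ^+ 2 * d1%:R * d2%:R by rewrite divfK // gt_eqF.
have row_le d k (C : 'M[R]_(k, d)) i : (0 < k)%N ->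
    norm2inf_le C (Num.sqrt (mu * d%:R / k%:R)) -> rownorm C i ^+ 2 <= mu * d%:R / k%:R.
  move=> k0 /(_ i) h.
  have q0 : 0 <= mu * d%:R / k%:R by rewrite divr_ge0 // mulr_ge0 // ltW.
  rewrite -(sqr_sqrtr q0) lerXn2r ?nnegrE ?sqrtr_ge0 //.
have short k : \tr ((entry_vec A B k)^T *m entry_vec A B k) <= L.
  rewrite entry_vec_norm //.
  have -> : L = mu * d1%:R / n1%:R * (mu * d2%:R / n2%:R).
    by rewrite /L NE; field; rewrite !gt_eqF.
  by apply: ler_pM; rewrite ?sqr_ge0 ?row_le.
have tight := entry_vec_tight iA iB.
have D0 : (0 < d1 * d2)%N by rewrite muln_gt0 d10.
have Dn : (d1 * d2 <= n ^ 2)%N.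
  by rewrite expnS expn1 leq_mul // ?(leq_trans dn1) ?(leq_trans dn2) // leq_max leqnn ?orbT.
have mT : (m <= N)%N by rewrite /N card_prod !card_ord.
have mL : 32 * (L * N%:R) * ln n%:R <= m%:R by move: hm; rewrite LN !mulrA.
have m0 : 0 < m%:R :> R.
  apply: (lt_le_trans _ mL); apply: mulr_gt0; last by rewrite ln_gt0 ?ltr1n.
  by do 2![apply: mulr_gt0 => //].
have up := frame_sampling_upper tight L0 short D0 n1' Dn mT mL.
have lw := frame_sampling_lower tight L0 short D0 n1' Dn mT mL.
apply: (prob_unif_subsets_ge mN _ up lw) => Om cO /asboolPn nU /asboolPn nL U V e0 b0 it.
apply: (@gnimc_quadratic _ _ _ _ _ _ A B Xs sr (64^-1 * (m%:R / N%:R)) Om U V) => //.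
- exact: leq_trans rd1 dn1.
- exact: leq_trans rd2 dn2.
- by rewrite mulr_gt0 ?invr_gt0 // divr_gt0.
move=> X; rewrite -(entry_vec_form A B) frob2 -mxvec_dot -[X in \tr (X *m _)]trmxK.
set z := (mxvec X)^T; apply/andP; split.
  by rewrite leNgt; apply/negP => h; apply: nL; exists z.
(* 1280 is the ratio of the upper level 20 to the lower level [1 / 64]. *)
have -> : 1280 * (64^-1 * (m%:R / N%:R)) = 20 * (m%:R / N%:R) :> R by lra.
by rewrite leNgt; apply/negP => h; apply: nU; exists z.
Qed.
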